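(* Let $E\to M$ be a vector bundle. The embedding $\iota:\mathcal D'(M,E)\to\mathcal G^{\{E\}}_{loc}(E)$ is a sheaf morphism, i.e. for any open subset $M'\subseteq M$ and $u\in\mathcal D'(M,E)$ we have $\iota(u)|_{M'}=\iota(u|_{M'})$ in $\mathcal G^{\{E\}}_{loc}(M',E)$.
   Context: Conventions. $\mathbb K\in\{\mathbb R,\mathbb C\}$ is fixed, $I=(0,1]$. Manifolds are real, smooth, Hausdorff and paracompact. All vector bundles are assumed natural, i.e. given by a vector bundle functor on manifolds of a fixed dimension and local diffeomorphisms (this serves to have Lie derivatives of sections). $\Gamma(E)$ (resp. $\Gamma_c(E)$) is the space of smooth (resp. compactly supported smooth) sections with its usual (resp. (LF)) topology. $\mathrm{Vol}(M)$ is the volume (density) bundle. $\mathcal D'(M,E)=(\Gamma_c(E^*\otimes\mathrm{Vol}(M)))'$ with the strong topology. $\mathcal L(A,B)$ is the space of continuous linear maps with the topology of uniform convergence on bounded sets; $\mathrm{csn}(A)$ is the set of continuous seminorms of $A$. $\mathrm{VSO}(E)=\mathcal L(\mathcal D'(M,E),\Gamma(E))$. Basic space. For a finite set $\Delta$ of vector bundles over $M$ (here $\Delta=\{E\}$) put $\mathrm{VSO}(\Delta)=\prod_{G\in\Delta}\mathrm{VSO}(G)$ and $\mathcal E^\Delta(E)=C^\infty(\mathrm{VSO}(\Delta),\Gamma(E))$, smoothness being understood in the convenient calculus of Kriegl and Michor, with $j$-th differential $\mathrm d^jR$. For $U\subseteq M$ open, $\Gamma(U,E)$, $\mathcal D'(U,E)$,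 $\mathrm{VSO}(U,\Delta)$, $\mathcal E^\Delta(U,E)$ and all other notions below are the corresponding objects for the manifold $U$ and the bundles $E|_U$, $G|_U$ ($G\in\Delta$). $\iota$ is given by $(\iota u)(\Phi)=\Phi(u)$; its values are local and moderate, and $\iota(u)$ also denotes the class in $\mathcal G^{\{E\}}_{loc}(E)$ (likewise over open subsets). Test objects. For a net $(\Phi_\varepsilon)_{\varepsilon\in I}$ in $\mathrm{VSO}(E)$ consider: (VSO1) for every Riemannian metric $g$ on $M$ and every $x_0\in M$ there is an open neighborhood $V$ of $x_0$ such that for all $r>0$ there is $\varepsilon_0\in I$ such that for all $x\in V$, $\varepsilon\le\varepsilon_0$, $u\in\mathcal D'(M,E)$: $u|_{B^g_r(x)}=0\Rightarrow\Phi_\varepsilon(u)(x)=0$, where $B^g_r(x)$ is the metric ball; (VSO2) $\Phi_\varepsilon\to\mathrm{id}$ in $\mathcal L(\mathcal D'(M,E),\mathcal D'(M,E))$ as $\varepsilon\to0$; (VSO3) for all $p\in\mathrm{csn}(\mathrm{VSO}(E))$ there is $N\in\mathbb N$ with $p(\Phi_\varepsilon)=O(\varepsilon^{-N})$; (VSO4) for all $p\in\mathrm{csn}(\mathcal L(\Gamma(E),\Gamma(E)))$ and $m\in\mathbb N$, $p(\Phi_\varepsilon|_{\Gamma(E)}-\mathrm{id})=O(\varepsilon^m)$. (VSO2') and (VSO4') are (VSO2) and (VSO4) with $\mathrm{id}$ replaced by $0$. $S(E)$ (test objects) is the set of nets satisfying (VSO1)–(VSO4), $S^0(E)$ ($0$-test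 objects) those satisfying (VSO1), (VSO2'), (VSO3), (VSO4'). $S(\Delta)=\prod_{G\in\Delta}S(G)$, $S^0(\Delta)=\prod_{G\in\Delta}S^0(G)$. A subset $A$ of $S(E)$ (or of $S^0(E)$) is uniform if the respective conditions hold uniformly on $A$: $V$ and $\varepsilon_0$ in (VSO1) and $N$ in (VSO3) can be chosen independently of the element of $A$, and the other statements hold with $p(\cdot)$ replaced by the supremum of $p(\cdot)$ over $A$ ((VSO2) being read as $p(\Phi_\varepsilon-\mathrm{id})\to0$ for all $p$, and similarly (VSO2')). A subset of $S(\Delta)$ or $S^0(\Delta)$ is uniform if each of its components is. Moderateness, negligibility. $R\in\mathcal E^\Delta(E)$ is moderate, $R\in\mathcal E^\Delta_{\mathcal M}(E)$, if for all $p\in\mathrm{csn}(\Gamma(E))$ and $j\in\mathbb N_0$ there is $N\in\mathbb N$ such that for all uniform $A\subseteq S(\Delta)$, $B\subseteq S^0(\Delta)$ one has $p((\mathrm d^jR)(\Phi_\varepsilon)(\Psi_{1,\varepsilon},\dots,\Psi_{j,\varepsilon}))=O(\varepsilon^{-N})$ uniformly for $(\Phi_\varepsilon)_\varepsilon\in A$, $(\Psi_{i,\varepsilon})_\varepsilon\in B$. $R$ is negligible, $R\in\mathcal N^\Delta(E)$, if for all $p$, $j$, all $m\in\mathbb N_0$ and all uniform $A,B$ as before the same expression is $O(\varepsilon^m)$ uniformly. Locality. $R\in\mathcal E^\Delta(E)$ is local, $R\in\mathcal E^\Delta_{loc}(E)$, if for all $\Phi,\Phi'\in\mathrm{VSO}(\Delta)$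 and open $U\subseteq M$: if $\Phi_G(u)|_U=\Phi'_G(u)|_U$ for all $G\in\Delta$ and $u\in\mathcal D'(M,G)$, then $R(\Phi)|_U=R(\Phi')|_U$. Put $\mathcal G^\Delta_{loc}(E)=(\mathcal E^\Delta_{\mathcal M}(E)\cap\mathcal E^\Delta_{loc}(E))/(\mathcal N^\Delta(E)\cap\mathcal E^\Delta_{loc}(E))$, and correspondingly $\mathcal G^\Delta_{loc}(U,E)$ for open $U$. Restriction. For $V\subseteq U$ open and $R\in\mathcal E^\Delta_{loc}(U,E)$, $R|_V$ is the unique element of $\mathcal E^\Delta_{loc}(V,E)$ such that for every open $W\subseteq V$, $\Phi\in\mathrm{VSO}(V,\Delta)$, $\Phi'\in\mathrm{VSO}(U,\Delta)$ with $\Phi_G(u|_V)|_W=\Phi'_G(u)|_W$ for all $G\in\Delta$, $u\in\mathcal D'(U,G)$, one has $(R|_V)(\Phi)|_W=R(\Phi')|_W$. On classes, $[R]|_V=[R|_V]$. *)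

(* Defs.v *)
From HB Require Import structures.
From mathcomp Require Import all_boot all_order all_algebra.
From mathcomp Require Import complex.
From mathcomp Require Import ring.
From mathcomp Require Import all_classical all_reals all_analysis.

Set Implicit Arguments.
Unset Strict Implicit.
Unset Printing Implicit Defensive.

Import Order.TTheory GRing.Theory Num.Theory.
Import numFieldNormedType.Exports.

Local Open Scope classical_set_scope.
Local Open Scope ring_scope.

Variant scalar_kind := RealScalars | ComplexScalars.

Section Scalars.
Variable R : realType.

Definition scalars (k : scalar_kind) : numFieldType :=
  match k with RealScalars => R | ComplexScalars => R[i] end.

Definition sRe k : scalars k -> R :=
  match k with
  | RealScalars => fun z : R => z
  | ComplexScalars => fun z : R[i] => complex.Re z
  end.

Definition sIm k : scalars k -> R :=
  match k with
  | RealScalars => fun _ : R => 0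
  | ComplexScalars => fun z : R[i] => complex.Im z
  end.

(* [a + i b]; the imaginary part is dropped for real scalars. *)
Definition sMk k : R -> R -> scalars k :=
  match k with
  | RealScalars => fun a _ => a
  | ComplexScalars => fun a b => (a +i* b)%C
  end.

Definition of_real k (a : R) : scalars k := sMk k a 0.

Definition sabs k (z : scalars k) : R := Num.sqrt (sRe z ^+ 2 + sIm z ^+ 2).

Lemma sReD k : {morph @sRe k : x y / x + y}.
Proof. by case: k => //= -[? ?] [? ?]. Qed.

Lemma sImD k : {morph @sIm k : x y / x + y}.
Proof. by case: k => /= [? ?|[? ?] [? ?] //]; rewrite addr0. Qed.

Lemma sReM k (x y : scalars k) : sRe (x * y) = sRe x * sRe y - sIm x * sIm y.
Proof. by case: k x y => /= [? ?|[? ?] [? ?] //]; rewrite mulr0 subr0. Qed.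

Lemma sImM k (x y : scalars k) : sIm (x * y) = sRe x * sIm y + sIm x * sRe y.
Proof. by case: k x y => /= [? ?|[? ?] [? ?] //]; rewrite mulr0 mul0r addr0. Qed.

Lemma sRe0 k : sRe (0 : scalars k) = 0. Proof. by case: k. Qed.
Lemma sIm0 k : sIm (0 : scalars k) = 0. Proof. by case: k. Qed.

Lemma sabs_ge0 k (z : scalars k) : 0 <= sabs z. Proof. exact: sqrtr_ge0. Qed.

Lemma sabsM k (x y : scalars k) : sabs (x * y) = sabs x * sabs y.
Proof.
rewrite /sabs -sqrtrM ?addr_ge0 ?sqr_ge0 // sReM sImM; congr Num.sqrt.
by rewrite !expr2 !(mulrDl, mulrDr, mulNr, mulrN, opprK); ring.
Qed.

Lemma sabs0 k : sabs (0 : scalars k) = 0.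
Proof. by rewrite /sabs sRe0 sIm0 expr0n /= addr0 sqrtr0. Qed.

End Scalars.

(* Locally convex spaces, presented by a family of seminorms generating the
   topology; [csn] is the set of all continuous seminorms. *)
Section LocallyConvex.
Variables (R : realType) (k : scalar_kind).
Local Notation K := (scalars R k).

Record lcs := Lcs {
  lcs_sort :> lmodType K;
  lcs_gen : set (lcs_sort -> R) }.

Definition is_seminorm (V : lmodType K) (p : V -> R) :=
  (forall x y, p (x + y) <= p x + p y) /\
  (forall a x, p (a *: x) = sabs a * p x).

Definition csn (A : lcs) : set (A -> R) :=
  [set q | is_seminorm q /\
    exists (m : nat) (C : nat -> R) (p : nat -> A -> R),
      (forall i, (i < m)%N -> lcs_gen (p i)) /\
      (forall x, q x <= \sum_(i < m) C i * p i x)].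

Definition bounded_in (A : lcs) (B : set A) :=
  forall p, csn p -> exists C : R, forall x, B x -> p x <= C.

Definition scalar_lcs : lcs := @Lcs K^o [set @sabs R k].

Definition cont_linear (A B : lcs) (f : A -> B) : Prop :=
  (forall a x y, f (a *: x + y) = a *: f x + f y) /\
  (forall q, csn q -> csn (q \o f)).

Lemma csnD (A : lcs) (p q : A -> R) : csn p -> csn q -> csn (p \+ q).
Proof.
move=> [[pD pZ] [m [C [f [fg pf]]]]] [[qD qZ] [m' [C' [f' [fg' qf]]]]]; split.
  split=> [x y|a x] /=; first by rewrite addrACA lerD.
  by rewrite pZ qZ mulrDr.
exists (m + m')%N, (fun i => if (i < m)%N then C i else C' (i - m)%N),
  (fun i => if (i < m)%N then f i else f' (i - m)%N); split.
  move=> i ilt; case: ifPn => [/fg//|]; rewrite -leqNgt => mi.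
  by apply: fg'; rewrite ltn_subLR.
move=> x /=; rewrite big_split_ord /= lerD //.
  by apply: le_trans (pf x) _; apply: ler_sum => i _; rewrite ltn_ord.
apply: le_trans (qf x) _; apply: ler_sum => i _.
by rewrite ltnNge leq_addr /= addKn.
Qed.

Lemma csn_le (A : lcs) (p q : A -> R) :
  is_seminorm q -> csn p -> (forall x, q x <= p x) -> csn q.
Proof.
move=> qs [_ [m [C [f [fg pf]]]]] qp; split=> //; exists m, C, f; split=> // x.
exact: le_trans (qp x) (pf x).
Qed.

Lemma csnZ (A : lcs) (c : R) (p : A -> R) : 0 <= c -> csn p -> csn (c \*o p).
Proof.
move=> c0 [[pD pZ] [m [C [f [fg pf]]]]]; split.
  split=> [x y|a x] /=; first by rewrite -mulrDr ler_wpM2l.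
  by rewrite pZ mulrCA.
exists m, (fun i => c * C i), f; split=> // x /=.
under eq_bigr do rewrite -mulrA.
by rewrite -mulr_sumr ler_wpM2l.
Qed.

Section CLin.
Variables A B : lcs.

Definition cont_linear_pred : {pred A -> B} := fun f => `[< cont_linear f >].

Lemma cont_linear_closed : submod_closed cont_linear_pred.
Proof.
split.
  apply/asboolP; split=> [a x y|q [[qD qZ] _]].
    by rewrite -[RHS]/(a *: (0 : B) + 0) scaler0 addr0.
  have q0 : q 0 = 0 by rewrite -(scale0r (0 : B)) qZ sabs0 mul0r.
  split.
    by split=> [x y|a x]; rewrite /= -?[_ 0 _]/(0 : B) !q0 ?addr0 ?mulr0.
  exists 0%N, (fun=> 0), (fun=> fun=> 0); split=> // x.
  by rewrite /= big_ord0 q0.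
move=> a f g /asboolP[fl fc] /asboolP[gl gc]; apply/asboolP.
have hl b x y : (a *: f + g) (b *: x + y)
     = b *: (a *: f + g) x + (a *: f + g) y.
  rewrite !fctE /= fl gl !scalerDr !scalerA [b * a]mulrC -!addrA.
  by congr (_ + _); rewrite addrCA.
split=> // q qc; have [[qD qZ] _] := qc.
apply: (@csn_le _ ((sabs a \*o (q \o f)) \+ (q \o g))).
- split=> [x y|b x] /=; first by rewrite -[x]scale1r hl !scale1r.
  have := hl b x 0; have -> : (a *: f + g) 0 = 0.
    have := hl (-1) 0 0; rewrite scaler0 addr0 scaleN1r addNr.
    by [].
  by rewrite !addr0 => ->; rewrite qZ.
- by apply: csnD; [apply: csnZ; [exact: sabs_ge0|exact: fc]|exact: gc].
by move=> x /=; rewrite -qZ; exact: qD.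
Qed.

HB.instance Definition _ :=
  GRing.isSubmodClosed.Build K (A -> B) cont_linear_pred cont_linear_closed.

Record clin_type := CLin {
  clin_fun :> A -> B; clin_funP : clin_fun \in cont_linear_pred }.

HB.instance Definition _ := [isSub for clin_fun].
HB.instance Definition _ := gen_eqMixin clin_type.
HB.instance Definition _ := gen_choiceMixin clin_type.
HB.instance Definition _ := [SubChoice_isSubLmodule of clin_type by <:].

(* Topology of uniform convergence on bounded sets *)
Definition clin : lcs := @Lcs clin_type
  [set r | exists q (D : set A), [/\ csn q, bounded_in D &
     r = fun f : clin_type => sup [set q (f x) | x in D]]].

(* The element of L(A, B) given by a map which is linear and continuous. *)
Definition to_clin (f : A -> B) : clin := insubd (0 : clin_type) f.

End CLin.

Definition curve_deriv (A : lcs) (c : R -> A) (t : R) (v : A) :=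
  forall p : A -> R, csn p ->
    p ((of_real k h^-1) *: (c (t + h) - c t) - v) @[h --> 0^'] --> (0 : R).

Definition smooth_curve (A : lcs) (c : R -> A) :=
  exists d : nat -> R -> A,
    d 0 = c /\ forall i t, curve_deriv (d i) t (d i.+1 t).

Definition conv_smooth (A B : lcs) (f : A -> B) :=
  forall c, smooth_curve c -> smooth_curve (f \o c).

Definition dir_diff (A B : lcs) (f : A -> B) (v : A) (x : A) : B :=
  xget 0 [set w | curve_deriv (fun t => f (x + of_real k t *: v)) 0 w].

(* [differential f x [:: v_1; ...; v_j]] is d^j f (x) (v_1, ..., v_j). *)
Definition differential (A B : lcs) (f : A -> B) (x : A) (vs : seq A) : B :=
  foldr (fun v g => dir_diff g v) f vs x.

End LocallyConvex.

Section Smoothness.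
Variable R : realType.

Definition basis_vec n (i : 'I_n) : 'rV[R]_n := delta_mx 0 i.

(* [d] is the family of all iterated partial derivatives of [f]. *)
Definition smooth_on n (O : set 'rV[R]_n) (f : 'rV[R]_n -> R) :=
  exists d : seq 'I_n -> 'rV[R]_n -> R,
    d [::] = f /\
    forall l x, O x ->
      {for x, continuous (d l)} /\
      forall i, is_derive x (basis_vec i) (d l) (d (i :: l) x).

Definition iter_partial n (l : seq 'I_n) (f : 'rV[R]_n -> R)
    : 'rV[R]_n -> R :=
  foldr (fun i g => 'D_(basis_vec i) g) f l.

Lemma smooth_on_lin n (O : set 'rV[R]_n) (a b : R) f g :
  smooth_on O f -> smooth_on O g -> smooth_on O (a *: f + b *: g).
Proof.
move=> [d [d0 dP]] [e [e0 eP]]; exists (fun l => a *: d l + b *: e l).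
split=> [|l x Ox]; first by rewrite d0 e0.
have [dc dd] := dP l x Ox; have [ec ed] := eP l x Ox; split=> [|i].
  by apply: continuousD; apply: continuousZr => //; exact: cvg_cst.
have := dd i; have := ed i; move=> ? ?; exact: is_deriveD.
Qed.

(* Lebesgue integral over R^n of a compactly supported continuous function,
   as an iterated integral. *)
Fixpoint integral_Rn n : ('rV[R]_n -> R) -> R :=
  match n with
  | 0 => fun f => f 0
  | m.+1 => fun f => \int[lebesgue_measure]_t
      integral_Rn (fun y : 'rV[R]_m => f (row_mx (const_mx t : 'rV[R]_1) y))
  end.

(* A manifold of dimension n is a topological space with an indexed atlas;
   the conditions are collected in [is_manifold]. Chart maps are total
   functions of which only the values on the chart domain matter. *)
Record premanifold (n : nat) := PreManifold {
  mcarrier :> topologicalType;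
  chart : Type;
  cdom : chart -> set mcarrier;
  cmap : chart -> mcarrier -> 'rV[R]_n }.

Section Charts.
Variables (n : nat) (M : premanifold n).

(* f \o c^-1 on the image of the chart c, and 0 elsewhere *)
Definition local_rep (c : chart M) (f : M -> R) (y : 'rV[R]_n) : R :=
  match pselect (exists x, cdom c x /\ cmap c x = y) with
  | left h => f (projT1 (cid h))
  | right _ => 0
  end.

Lemma local_rep_lin c a b f g :
  local_rep c (a *: f + b *: g) = a *: local_rep c f + b *: local_rep c g.
Proof.
apply/funext => y; rewrite /local_rep !fctE /=; case: pselect => // _.
by rewrite !scaler0 addr0.
Qed.

Definition smooth_in_chart (c : chart M) (O : set M) (f : M -> R) :=
  smooth_on (cmap c @` (cdom c `&` O)) (local_rep c f).

(* Jacobian matrix at x of the coordinate change c' \o c^-1 (acting on row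
   vectors) *)
Definition jacobian_mx (c c' : chart M) (x : M) : 'M[R]_n :=
  \matrix_(i, j)
    'D_(basis_vec i) (local_rep c (fun y => cmap c' y 0 j)) (cmap c x).

End Charts.

Definition paracompact (T : topologicalType) :=
  forall C : set (set T), (forall A, C A -> open A) -> \bigcup_(A in C) A = setT ->
  exists D : set (set T),
    [/\ forall B, D B -> open B /\ exists2 A, C A & B `<=` A,
        \bigcup_(B in D) B = setT &
        forall x : T, exists2 V, nbhs x V &
          finite_set [set B | D B /\ B `&` V !=set0]].

Record is_manifold n (M : premanifold n) : Prop := IsManifold {
  manifold_hausdorff : hausdorff_space M;
  manifold_paracompact : paracompact M;
  cdom_open : forall c : chart M, open (cdom c);
  cdom_cover : forall x : M, exists c : chart M, cdom c x;
  cmap_inj : forall (c : chart M) x y,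
    cdom c x -> cdom c y -> cmap c x = cmap c y -> x = y;
  cmap_cont : forall (c : chart M) x, cdom c x -> {for x, continuous (cmap c)};
  cmap_open : forall (c : chart M) (O : set M),
    open O -> O `<=` cdom c -> open (cmap c @` O);
  transition_smooth : forall (c c' : chart M) j,
    smooth_in_chart c (cdom c') (fun x => cmap c' x 0 j) }.

Definition open_submanifold n (M : premanifold n) (U : set M) : premanifold n :=
  @PreManifold n (set_type U) (chart M)
    (fun c => [set x | cdom c (val x)]) (fun c x => cmap c (val x)).

Definition smooth_map_on n (M N : premanifold n) (O : set M) (f : M -> N) :=
  (forall x, O x -> {for x, continuous f}) /\
  (forall (c : chart M) (d : chart N) j,
     smooth_in_chart c (O `&` f @^-1` cdom d) (fun x => cmap d (f x) 0 j)).

Definition local_diffeo n (M N : premanifold n) (f : M -> N) :=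
  forall x, exists (O : set M) (h : N -> M),
    [/\ open O /\ O x, open (f @` O), forall y, O y -> h (f y) = y,
        smooth_map_on O f & smooth_map_on (f @` O) h].

Section Riemannian.
Variables (n : nat) (M : premanifold n).

Definition quad (G : 'M[R]_n) (v : 'rV[R]_n) : R := (v *m G *m v^T) 0 0.

Record is_riemannian (g : chart M -> M -> 'M[R]_n) : Prop := IsRiemannian {
  metric_smooth : forall c i j, smooth_in_chart c setT (fun x => g c x i j);
  metric_change : forall c c' x, cdom c x -> cdom c' x ->
    g c x = jacobian_mx c c' x *m g c' x *m (jacobian_mx c c' x)^T;
  metric_sym : forall c x, cdom c x -> (g c x)^T = g c x;
  metric_pos : forall c x v, cdom c x -> v != 0 -> 0 < quad (g c x) v }.

Definition C1_curve (gam : R -> M) :=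
  continuous gam /\
  forall t c j, cdom c (gam t) ->
    derivable (fun s => cmap c (gam s) 0 j : R) t 1 /\
    {for t, continuous (derive1 (fun s => cmap c (gam s) 0 j : R))}.

Definition velocity (c : chart M) (gam : R -> M) (t : R) : 'rV[R]_n :=
  \row_j derive1 (fun s => cmap c (gam s) 0 j : R) t.

(* |gam'(t)|_g, which does not depend on the chart at gam t *)
Definition speed (g : chart M -> M -> 'M[R]_n) (gam : R -> M) (t : R) : R :=
  xget 0 [set s | exists2 c, cdom c (gam t) &
    s = Num.sqrt (quad (g c (gam t)) (velocity c gam t))].

Definition curve_length g (gam : R -> M) : R :=
  \int[lebesgue_measure]_(t in `[0, 1]%classic) speed g gam t.

(* [joined g x y l]: a piecewise C^1 curve of length l leads from x to y. *)
Inductive joined (g : chart M -> M -> 'M[R]_n) : M -> M -> R -> Prop :=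
| joined_refl x : joined g x x 0
| joined_step gam y l : C1_curve gam -> joined g (gam 1) y l ->
    joined g (gam 0) y (curve_length g gam + l).

Definition riem_dist g (x y : M) : \bar R :=
  ereal_inf [set l%:E | l in joined g x y].

Definition metric_ball g (x : M) (r : R) : set M :=
  [set y | (riem_dist g x y < r%:E)%E].

End Riemannian.
End Smoothness.

Section Bundles.
Variables (R : realType) (k : scalar_kind) (n : nat).
Local Notation K := (scalars R k).

(* Vector bundles, by their fibres and an indexed family of local
   trivializations; the conditions are collected in [is_vbundle]. *)
Record prebundle (M : premanifold R n) := PreBundle {
  rank : nat;
  fibre : M -> lmodType K;
  triv : Type;
  tdom : triv -> set M;
  tmap : forall (i : triv) (x : M), {linear fibre x -> 'rV[K]_rank} }.

Definition local_frame (M : premanifold R n) (E : prebundle M)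
    (i : triv E) (a : 'I_(rank E)) (x : M) : fibre E x :=
  xget 0 [set e | tmap i x e = delta_mx 0 a].

Definition smooth_scalar (M : premanifold R n) (c : chart M) (O : set M)
    (f : M -> K) :=
  smooth_in_chart c O (@sRe R k \o f) /\ smooth_in_chart c O (@sIm R k \o f).

Record is_vbundle (M : premanifold R n) (E : prebundle M) : Prop := IsVBundle {
  tdom_open : forall i : triv E, open (tdom i);
  tdom_cover : forall x : M, exists i : triv E, tdom i x;
  tmap_bij : forall (i : triv E) x, tdom i x -> bijective (tmap i x);
  tmap_smooth : forall (i j : triv E) c a b,
    smooth_scalar c (tdom i `&` tdom j)
      (fun x => tmap j x (local_frame i a x) 0 b) }.

Definition bundle_restr (M : premanifold R n) (U : set M) (E : prebundle M)
    : prebundle (open_submanifold U) :=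
  @PreBundle (open_submanifold U) (rank E) (fun x => fibre E (val x)) (triv E)
    (fun i => [set x | tdom i (val x)]) (fun i x => tmap i (val x)).

Definition raw_section (M : premanifold R n) (E : prebundle M) :=
  forall x : M, fibre E x.

Section RawSection.
Variables (M : premanifold R n) (E : prebundle M).
Implicit Types s t : raw_section E.

HB.instance Definition _ := gen_eqMixin (raw_section E).
HB.instance Definition _ := gen_choiceMixin (raw_section E).

Let add s t : raw_section E := fun x => s x + t x.
Let opp s : raw_section E := fun x => - s x.
Let zero : raw_section E := fun=> 0.
Let scale (a : K) s : raw_section E := fun x => a *: s x.

Let ext s t : (forall x, s x = t x) -> s = t.
Proof. exact: functional_extensionality_dep. Qed.

Let addA : associative add.
Proof. by move=> s t u; apply: ext => x; exact: addrA. Qed.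
Let addC : commutative add.
Proof. by move=> s t; apply: ext => x; exact: addrC. Qed.
Let add0 : left_id zero add.
Proof. by move=> s; apply: ext => x; exact: add0r. Qed.
Let addN : left_inverse zero opp add.
Proof. by move=> s; apply: ext => x; exact: addNr. Qed.

HB.instance Definition _ :=
  GRing.isZmodule.Build (raw_section E) addA addC add0 addN.

Let scaleA a b s : scale a (scale b s) = scale (a * b) s.
Proof. by apply: ext => x; exact: scalerA. Qed.
Let scale1 : left_id 1 scale.
Proof. by move=> s; apply: ext => x; exact: scale1r. Qed.
Let scaleDr : right_distributive scale +%R.
Proof. by move=> a s t; apply: ext => x; exact: scalerDr. Qed.
Let scaleDl s : {morph scale^~ s : a b / a + b}.
Proof. by move=> a b; apply: ext => x; exact: scalerDl. Qed.

HB.instance Definition _ :=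
  GRing.Zmodule_isLmodule.Build K (raw_section E) scaleA scale1 scaleDr scaleDl.

End RawSection.

Section Sections.
Variables (M : premanifold R n) (E : prebundle M).

Definition coord (i : triv E) (a : 'I_(rank E)) (s : raw_section E) (x : M) : K :=
  tmap i x (s x) 0 a.

Definition smooth_section (s : raw_section E) :=
  forall c i a, smooth_scalar c (tdom i) (coord i a s).

Definition supp (s : raw_section E) : set M := closure [set x | s x <> 0].

Lemma smooth_section0 : smooth_section 0.
Proof.
move=> c i a; have z (f : M -> R) : (forall x, f x = 0) -> smooth_in_chart c (tdom i) f.
  move=> f0; exists (fun=> fun=> 0); split.
    by apply/funext => y; rewrite /local_rep; case: pselect => // ?; rewrite f0.
  move=> l x _; split=> [|j]; first exact: cst_continuous.
  exact: is_derive_cst.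
by split; apply: z => x; rewrite /= /coord linear0 mxE ?sRe0 ?sIm0.
Qed.

Lemma smooth_sectionP (a : K) s t :
  smooth_section s -> smooth_section t -> smooth_section (a *: s + t).
Proof.
move=> ss st c i b; have [s1 s2] := ss c i b; have [t1 t2] := st c i b.
have cE : coord i b (a *: s + t) = fun x => a * coord i b s x + coord i b t x.
  by apply/funext => x; rewrite /coord linearP !mxE.
have lin (p q r : M -> R) u v : smooth_in_chart c (tdom i) p ->
    smooth_in_chart c (tdom i) q -> smooth_in_chart c (tdom i) r ->
    smooth_in_chart c (tdom i) (1 *: (u *: p + v *: q) + 1 *: r).
  move=> hp hq hr; rewrite /smooth_in_chart !local_rep_lin.
  by apply: smooth_on_lin => //; apply: smooth_on_lin.
split; rewrite cE.
  have := lin _ _ _ (sRe a) (- sIm a) s1 s2 t1; congr smooth_in_chart.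
  by apply/funext => x /=; rewrite sReD sReM !fctE /= !scale1r scaleNr.
have := lin _ _ _ (sRe a) (sIm a) s2 s1 t2; congr smooth_in_chart.
by apply/funext => x /=; rewrite sImD sImM !fctE /= !scale1r.
Qed.

Definition smooth_section_pred : {pred raw_section E} :=
  fun s => `[< smooth_section s >].

Lemma smooth_section_closed : submod_closed smooth_section_pred.
Proof.
split; first by apply/asboolP; exact: smooth_section0.
by move=> a s t /asboolP ? /asboolP ?; apply/asboolP; exact: smooth_sectionP.
Qed.

HB.instance Definition _ := GRing.isSubmodClosed.Build
  K (raw_section E) smooth_section_pred smooth_section_closed.

Record section_type := Section {
  section_fun :> raw_section E;
  section_funP : section_fun \in smooth_section_pred }.

HB.instance Definition _ := [isSub for section_fun].
HB.instance Definition _ := gen_eqMixin section_type.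
HB.instance Definition _ := gen_choiceMixin section_type.
HB.instance Definition _ := [SubChoice_isSubLmodule of section_type by <:].

(* Supremum over L of the modulus of a partial derivative of a component of
   the section in a chart and a local trivialization *)
Definition section_seminorm (c : chart M) (i : triv E) (L : set M)
    (l : seq 'I_n) (a : 'I_(rank E)) (s : section_type) : R :=
  sup [set Num.sqrt
     (iter_partial l (local_rep c (@sRe R k \o coord i a s)) (cmap c x) ^+ 2 +
      iter_partial l (local_rep c (@sIm R k \o coord i a s)) (cmap c x) ^+ 2)
    | x in L].

Definition Gamma : lcs R k := @Lcs R k section_type
  [set p | exists c i L l a, [/\ compact L, L `<=` cdom c `&` tdom i &
     p = section_seminorm c i L l a]].

Definition csection_pred : {pred raw_section E} :=
  fun s => `[< smooth_section s /\ compact (supp s) >].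

Lemma csection_closed : submod_closed csection_pred.
Proof.
split.
  apply/asboolP; split; first exact: smooth_section0.
  rewrite /supp (_ : [set x | _] = set0) ?closure0; first exact: compact0.
  by rewrite -subset0 => x /=; exact.
move=> a s t /asboolP[ss cs] /asboolP[st ct]; apply/asboolP.
split; first exact: smooth_sectionP.
apply: (subclosed_compact _ (compactU cs ct)); first exact: closed_closure.
rewrite /supp -closureU; apply: closure_subset => x /= nz.
apply: contrapT => /not_orP[/contrapT sx /contrapT tx]; apply: nz.
have -> : (a *: s + t) x = a *: s x + t x by [].
by rewrite sx tx scaler0 addr0.
Qed.

HB.instance Definition _ := GRing.isSubmodClosed.Build
  K (raw_section E) csection_pred csection_closed.

Record csection_type := CSection {
  csection_fun :> raw_section E;
  csection_funP : csection_fun \in csection_pred }.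

HB.instance Definition _ := [isSub for csection_fun].
HB.instance Definition _ := gen_eqMixin csection_type.
HB.instance Definition _ := gen_choiceMixin csection_type.
HB.instance Definition _ := [SubChoice_isSubLmodule of csection_type by <:].

Lemma csection_smooth (s : csection_type) :
  (s : raw_section E) \in smooth_section_pred.
Proof. by have /asboolP[ss _] := csection_funP s; apply/asboolP. Qed.

Definition csection_section (s : csection_type) : Gamma :=
  Section (csection_smooth s).

(* Gamma_c(E) with its (LF) topology: a seminorm is continuous iff its
   restriction to the sections supported in L is, for each compact L. *)
Definition Gammac : lcs R k := @Lcs R k csection_type
  [set p | is_seminorm p /\ forall L : set M, compact L ->
     exists2 q : Gamma -> R, csn q &
       forall s : csection_type, supp s `<=` L -> p s <= q (csection_section s)].

End Sections.

(* E^* (x) Vol(M): the fibre at x consists of the linear maps from E_x to the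
   (K-valued) densities of T_x M. A density is encoded by its coefficients in
   the charts at x, which transform with the modulus of the Jacobian
   determinant; the coefficients in the other charts are set to 0. *)
Section DualDensity.
Variables (M : premanifold R n) (E : prebundle M).

Definition is_dual_density (x : M) (w : chart M -> fibre E x -> K^o) :=
  [/\ forall c (a : K) e f, w c (a *: e + f) = a *: w c e + w c f,
      forall c, ~ cdom c x -> w c = 0 &
      forall c c', cdom c x -> cdom c' x -> forall e,
        w c e = of_real k `|\det (jacobian_mx c c' x)| * w c' e].

Definition dual_density_pred x : {pred chart M -> fibre E x -> K^o} :=
  fun w => `[< is_dual_density w >].

Lemma dual_density_closed x : submod_closed (@dual_density_pred x).
Proof.
split.
  apply/asboolP; split=> // [c a e f|c c' _ _ e].
    by rewrite -[RHS]/(a *: (0 : K^o) + 0) scaler0 addr0.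
  by rewrite -[RHS]/(_ * 0) mulr0.
move=> a v w /asboolP[vl vz vt] /asboolP[wl wz wt]; apply/asboolP; split.
- move=> c b e f; rewrite !fctE /= vl wl !scalerDr !scalerA [b * a]mulrC -!addrA.
  by congr (_ + _); rewrite addrCA.
- move=> c nc; apply/funext => e; have := congr1 (@^~ e) (vz c nc).
  have := congr1 (@^~ e) (wz c nc); rewrite !fctE /= => -> ->.
  by rewrite scaler0 addr0.
move=> c c' cx c'x e; rewrite !fctE /= (vt _ _ cx c'x) (wt _ _ cx c'x).
by rewrite mulrDr scalerAr.
Qed.

HB.instance Definition _ x := GRing.isSubmodClosed.Build
  K (chart M -> fibre E x -> K^o) (@dual_density_pred x) (dual_density_closed x).

Record dual_density (x : M) := DualDensity {
  dd_fun :> chart M -> fibre E x -> K^o;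
  dd_funP : dd_fun \in @dual_density_pred x }.

HB.instance Definition _ x := [isSub for @dd_fun x].
HB.instance Definition _ x := gen_eqMixin (dual_density x).
HB.instance Definition _ x := gen_choiceMixin (dual_density x).
HB.instance Definition _ x := [SubChoice_isSubLmodule of dual_density x by <:].

Definition dd_coords (ci : chart M * triv E) (x : M) (w : dual_density x)
    : 'rV[K]_(rank E) :=
  \row_a w ci.1 (local_frame ci.2 a x).

Lemma dd_coords_linear ci x : linear (@dd_coords ci x).
Proof. by move=> a v w; apply/rowP => j; rewrite !mxE. Qed.

HB.instance Definition _ ci x := GRing.isLinear.Build K (dual_density x)
  'rV[K]_(rank E) _ (@dd_coords ci x) (@dd_coords_linear ci x).

Definition dual_vol : prebundle M :=
  @PreBundle M (rank E) (fun x => dual_density x) (chart M * triv E)%type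
    (fun ci => cdom ci.1 `&` tdom ci.2) (fun ci x => @dd_coords ci x).

End DualDensity.

Definition Distr (M : premanifold R n) (E : prebundle M) : lcs R k :=
  clin (Gammac (dual_vol E)) (scalar_lcs R k).

Definition VSO (M : premanifold R n) (E : prebundle M) : lcs R k :=
  clin (Distr E) (Gamma E).

(* Extension of w by 0 outside U *)
Definition ext0 (M : premanifold R n) (U : set M) (E : prebundle M)
    (w : Gammac (dual_vol (bundle_restr U E))) : Gammac (dual_vol E) :=
  insubd (0 : csection_type (dual_vol E))
    ((fun x => match pselect (U x) with
       | left h => insubd (0 : dual_density E x)
           (dd_fun (csection_fun w (exist _ x (mem_set h)))
             : chart M -> fibre E x -> K^o)
       | right _ => 0
       end) : raw_section (dual_vol E)).

Definition distr_restr (M : premanifold R n) (U : set M) (E : prebundle M)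
    (u : Distr E) : Distr (bundle_restr U E) :=
  to_clin (fun w : Gammac (dual_vol (bundle_restr U E)) => clin_fun u (ext0 w)).

Definition vanishes_on (M : premanifold R n) (E : prebundle M)
    (u : Distr E) (B : set M) :=
  forall w : Gammac (dual_vol E), supp (csection_fun w) `<=` B -> clin_fun u w = 0.

(* The regular distribution of a section s, w |-> int_M w(s), determined by
   its values on the w supported in a chart domain *)
Definition regular (M : premanifold R n) (E : prebundle M) (s : Gamma E) : Distr E :=
  xget 0 [set T : Distr E | forall (c : chart M) (w : Gammac (dual_vol E)),
    supp (csection_fun w) `<=` cdom c ->
    let f x : K := dd_fun (csection_fun w x) c (section_fun s x) in
    clin_fun T w = sMk k (integral_Rn (local_rep c (@sRe R k \o f)))
                         (integral_Rn (local_rep c (@sIm R k \o f)))].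

Record bundle_functor := BundleFunctor {
  bobj : forall M : premanifold R n, prebundle M;
  bmor : forall (M N : premanifold R n) (f : M -> N) (x : M),
    {linear fibre (bobj M) x -> fibre (bobj N) (f x)} }.

Definition smooth_bundle_map (M N : premanifold R n) (E : prebundle M)
    (F : prebundle N) (f : M -> N) (h : forall x, fibre E x -> fibre F (f x)) :=
  forall c (i : triv E) (j : triv F) a b,
    smooth_scalar c (tdom i `&` f @^-1` tdom j)
      (fun x => tmap j (f x) (h x (local_frame i a x)) 0 b).

Record is_bundle_functor (F : bundle_functor) : Prop := IsBundleFunctor {
  bobj_vbundle : forall M, is_manifold M -> is_vbundle (bobj F M);
  bmor_bij : forall (M N : premanifold R n) (f : M -> N), is_manifold M -> is_manifold N ->
    local_diffeo f -> forall x, bijective (bmor F f x);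
  bmor_smooth : forall (M N : premanifold R n) (f : M -> N), is_manifold M -> is_manifold N ->
    local_diffeo f -> smooth_bundle_map (fun x v => bmor F f x v);
  bmor_id : forall (M : premanifold R n) x v, is_manifold M ->
    bmor F (@id M) x v = v;
  bmor_comp : forall (M N P : premanifold R n) (f : M -> N) (g : N -> P),
    is_manifold M -> is_manifold N -> is_manifold P -> local_diffeo f -> local_diffeo g ->
    forall x v, bmor F (g \o f) x v = bmor F g (f x) (bmor F f x v) }.

Definition natural_bundle (M : premanifold R n) (E : prebundle M) :=
  exists F : bundle_functor, is_bundle_functor F /\
    exists h : forall x : M, {linear fibre (bobj F M) x -> fibre E x},
      (forall x, bijective (h x)) /\
      smooth_bundle_map (f := @id M) (fun x v => h x v).

Section TestObjects.
Variables (M : premanifold R n) (E : prebundle M).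

(* Nets indexed by (0, 1]; the values at other indices are irrelevant. *)
Definition net := R -> VSO E.

Implicit Types (A : set net) (Phi : net).

Definition VSO1 A :=
  forall g, is_riemannian g -> forall x0 : M,
    exists V : set M, [/\ open V, V x0 &
      forall r : R, 0 < r -> \forall e \near 0^'+,
        forall Phi x (u : Distr E), A Phi -> V x ->
          vanishes_on u (metric_ball g x r) ->
          section_fun (clin_fun (Phi e) u) x = 0].

Definition VSO2 (T : clin (Distr E) (Distr E)) A :=
  forall p, csn p -> forall d : R, 0 < d -> \forall e \near 0^'+,
    forall Phi, A Phi ->
      p (to_clin (fun u => regular (clin_fun (Phi e) u)) - T) <= d.

Definition VSO3 A :=
  forall p, csn p -> exists (N : nat) (C : R), \forall e \near 0^'+,
    forall Phi, A Phi -> p (Phi e) <= C * e ^- N.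

Definition VSO4 (T : clin (Gamma E) (Gamma E)) A :=
  forall p, csn p -> forall m : nat, exists C : R, \forall e \near 0^'+,
    forall Phi, A Phi ->
      p (to_clin (fun s => clin_fun (Phi e) (regular s)) - T) <= C * e ^+ m.

Definition test_conditions A :=
  [/\ VSO1 A, VSO2 (to_clin idfun) A, VSO3 A & VSO4 (to_clin idfun) A].

Definition test0_conditions A := [/\ VSO1 A, VSO2 0 A, VSO3 A & VSO4 0 A].

Definition test_objects : set net := [set Phi | test_conditions [set Phi]].
Definition test0_objects : set net := [set Phi | test0_conditions [set Phi]].

Definition uniform_test A := A `<=` test_objects /\ test_conditions A.
Definition uniform_test0 A := A `<=` test0_objects /\ test0_conditions A.

(* Maps VSO(E) -> Gamma(E); the basic space consists of the smooth ones. *)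
Definition basic := VSO E -> Gamma E.

Definition basic_smooth (Q : basic) := conv_smooth Q.

Definition moderate (Q : basic) :=
  basic_smooth Q /\
  forall p, csn p -> forall j : nat, exists N : nat,
    forall A B, uniform_test A -> uniform_test0 B ->
      exists C : R, \forall e \near 0^'+,
        forall Phi (Psi : 'I_j -> net), A Phi -> (forall i, B (Psi i)) ->
          p (differential Q (Phi e) [seq Psi i e | i <- enum 'I_j])
            <= C * e ^- N.

Definition negligible (Q : basic) :=
  basic_smooth Q /\
  forall p, csn p -> forall j m : nat,
    forall A B, uniform_test A -> uniform_test0 B ->
      exists C : R, \forall e \near 0^'+,
        forall Phi (Psi : 'I_j -> net), A Phi -> (forall i, B (Psi i)) ->
          p (differential Q (Phi e) [seq Psi i e | i <- enum 'I_j])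
            <= C * e ^+ m.

Definition local (Q : basic) :=
  basic_smooth Q /\
  forall (Phi Phi' : VSO E) (O : set M), open O ->
    (forall (u : Distr E) x, O x ->
      section_fun (clin_fun Phi u) x = section_fun (clin_fun Phi' u) x) ->
    forall x, O x -> section_fun (Q Phi) x = section_fun (Q Phi') x.

(* The class of Q modulo the negligible local elements, as a coset in the
   local elements; the classes of moderate local elements form the quotient
   [Gloc]. Classes are equal iff the difference of the representatives (if
   these are local) is negligible and local. *)
Definition gclass (Q : basic) : set basic :=
  [set S | local S /\ (negligible (S - Q) /\ local (S - Q))].

Definition Gloc : set (set basic) :=
  [set gclass Q | Q in [set Q | moderate Q /\ local Q]].

Definition iota_emb (u : Distr E) : basic := fun Phi : VSO E => clin_fun Phi u.

End TestObjects.

Section Restriction.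
Variables (M : premanifold R n) (U : set M) (E : prebundle M).

Definition is_restriction (Q : basic E) (Q' : basic (bundle_restr U E)) :=
  local Q' /\
  forall (W : set M) (Phi : VSO (bundle_restr U E)) (Phi' : VSO E),
    open W -> W `<=` U ->
    (forall (u : Distr E) (x : open_submanifold U), W (val x) ->
       section_fun (clin_fun Phi (distr_restr U u)) x
         = section_fun (clin_fun Phi' u) (val x) :> fibre E (val x)) ->
    forall x : open_submanifold U, W (val x) ->
      section_fun (Q' Phi) x = section_fun (Q Phi') (val x) :> fibre E (val x).

(* Q|_U, the unique element satisfying [is_restriction Q] (for local Q) *)
Definition restriction (Q : basic E) : basic (bundle_restr U E) :=
  xget (fun=> 0) [set Q' | is_restriction Q Q'].

End Restriction.

End Bundles.

Arguments restriction {R k n M} U {E} Q.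
Arguments distr_restr {R k n M} U {E} u.

(* Main.v *)
Require Import Defs.
From mathcomp Require Import all_boot all_order all_algebra.
From mathcomp Require Import all_classical all_reals all_analysis.
From mathcomp Require Import ring lra.

Set Implicit Arguments.
Unset Strict Implicit.
Unset Printing Implicit Defensive.

Import Order.TTheory GRing.Theory Num.Theory.
Import numFieldNormedType.Exports.

Local Open Scope classical_set_scope.
Local Open Scope ring_scope.

(** Both sides are classes of maps VSO(U) -> Gamma(U), U = M', and the
    representatives themselves agree: (iota u)|_U = iota(u|_U) as maps
    ([restriction_iota]). The map iota(u|_U) is local, because it is evaluation
    at a fixed distribution, and it satisfies the defining relation of the
    restriction of iota u, because that relation at iota u is the hypothesis on
    the pair (Phi, Phi') read at the single distribution u
    ([iota_is_restriction]).

    The work is in uniqueness. The defining relation determines the value of a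
    restriction at Phi near x0 only if some Phi' in VSO(M) satisfies
    Phi(v|_U) = Phi'(v) near x0 for all v in D'(M). Such an operator is
    Phi' = chi . Phi(. |_U), where chi is a bump function supported in a compact
    subset of U and equal to 1 near x0 ([vso_extension]). That Phi' is a
    continuous linear map from D'(M) to Gamma(M) rests on three facts.

    - Bump functions exist on manifolds ([bump]). In one variable they come from
      exp(-1/t); a chart transports them to M.
    - Multiplication by chi followed by extension by zero is continuous from
      Gamma(U) to Gamma(M) ([mult_section_cont]): by the Leibniz rule a seminorm
      of chi t over a compact set L is bounded by seminorms of t over the
      intersection of L with the support of chi.
    - Restriction of distributions is continuous from D'(M) to D'(U)
      ([distr_restr_cont]), being the transpose of the extension by zero of
      compactly supported densities. The latter is continuous ([ext0_cont]) by
      the same estimate with chi = 1, applied to the sections supported in a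
      fixed compact subset of U.

    The last two facts share one transfer lemma, [section_mult_ext_dominate],
    about a pair (s, t) of sections over M and over U such that s = chi t on U in
    every trivialization and s vanishes off a compact subset of U. *)

(** * Functions of class C^m on open subsets of R^n *)

Section Calculus.
Variables (R : realType) (n : nat).
Implicit Types (O P : set 'rV[R]_n) (f g h : 'rV[R]_n -> R).

(** A recursion on first derivatives, rather than the family of partial
    derivatives indexed by sequences that [smooth_on] asks for: products and
    compositions then become inductions on [m], since the derivative of a product
    or of a composite is built from functions of class C^(m-1). *)
Fixpoint Ck (m : nat) O f : Prop :=
  (forall x, O x -> {for x, continuous f}) /\
  if m is m'.+1 then
    forall i, (forall x, O x -> derivable f x (basis_vec R i)) /\
      Ck m' O ('D_(basis_vec R i) f)
  else True.

Definition Cinfty O f := forall m, Ck m O f.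

Lemma Ck_cont m O f x : Ck m O f -> O x -> {for x, continuous f}.
Proof. by case: m => [|m] [+ _] Ox; apply. Qed.

Lemma CkS m O f : Ck m.+1 O f -> Ck m O f.
Proof.
elim: m f => [|m IH] f [fc fd]; first by split.
by split=> // i; have [fi /IH] := fd i.
Qed.

Lemma near_open O (P : 'rV[R]_n -> Prop) x : open O -> (forall y, O y -> P y) -> O x ->
  \forall y \near x, P y.
Proof. by move=> oO OP Ox; apply: filterS OP _; exact: open_nbhs_nbhs. Qed.

Lemma eq_continuous_at (T U : topologicalType) (f g : T -> U) x :
  (\near x, f x = g x) -> {for x, continuous f} -> {for x, continuous g}.
Proof.
move=> fg cf; have fgx : f x = g x by exact: nbhs_singleton fg.
by move: cf; rewrite /prop_for /continuous_at -fgx; apply: cvg_trans; exact: near_eq_cvg.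
Qed.

Lemma eq_Ck m O f g : open O -> (forall x, O x -> f x = g x) ->
  Ck m O f -> Ck m O g.
Proof.
move=> oO; elim: m f g => [|m IH] f g fg [fc fd].
  by split=> // x Ox; apply: eq_continuous_at (fc x Ox); exact: near_open Ox.
split=> [x Ox|i]; first by apply: eq_continuous_at (fc x Ox); exact: near_open Ox.
have [fi fk] := fd i; split=> [x Ox|].
  by apply: near_eq_derivable (fi x Ox); exact: near_open Ox.
by apply: IH fk => x Ox; apply: near_eq_derive; exact: near_open Ox.
Qed.

Lemma sub_Ck m O P f : P `<=` O -> Ck m O f -> Ck m P f.
Proof.
move=> PO; elim: m f => [|m IH] f [fc fd].
  by split=> // x /PO; exact: fc.
split=> [x /PO|i]; first exact: fc.
by have [fi /IH] := fd i; split=> // x /PO; exact: fi.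
Qed.

(** Derivatives at a point see the function itself, not its restriction, so the
    sets [P] may be arbitrary. *)
Lemma local_Ck m O f :
  (forall x, O x -> exists2 P, P x & Ck m P f) -> Ck m O f.
Proof.
elim: m f => [|m IH] f H.
  by split=> // x /H[P Px [fc _]]; exact: fc.
split=> [x /H[P Px [fc _]]|i]; first exact: fc.
split=> [x /H[P Px [_ /(_ i)[fi _]]]|]; first exact: fi.
by apply: IH => x /H[P Px [_ /(_ i)[_ ?]]]; exists P.
Qed.

Lemma Ck_cst m O (c : R) : Ck m O (cst c).
Proof.
elim: m c => [|m IH] c; first by split=> // x _; exact: cst_continuous.
split=> [x _|i]; first exact: cst_continuous.
split=> [x _|]; first exact: derivable_cst.
by rewrite (_ : 'D__ _ = cst 0) //; apply/funext => x; rewrite derive_cst.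
Qed.

Lemma CkD m O f g : open O -> Ck m O f -> Ck m O g -> Ck m O (f + g).
Proof.
move=> oO; elim: m f g => [|m IH] f g [fc fd] [gc gd].
  by split=> // x Ox; apply: continuousD; [exact: fc|exact: gc].
split=> [x Ox|i]; first by apply: continuousD; [exact: fc|exact: gc].
have [fi fk] := fd i; have [gi gk] := gd i.
split=> [x Ox|]; first by apply: derivableD; [exact: fi|exact: gi].
apply: eq_Ck (IH _ _ fk gk) => // x Ox.
by rewrite deriveD //; [exact: fi|exact: gi].
Qed.

Lemma CkM m O f g : open O -> Ck m O f -> Ck m O g -> Ck m O (f * g).
Proof.
move=> oO; elim: m f g => [|m IH] f g Cf Cg.
  by split=> // x Ox; apply: continuousM; [exact: Ck_cont Cf Ox|exact: Ck_cont Cg Ox].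
split=> [x Ox|i].
  by apply: continuousM; [exact: Ck_cont Cf Ox|exact: Ck_cont Cg Ox].
have [_ /(_ i)[fi fk]] := Cf; have [_ /(_ i)[gi gk]] := Cg.
split=> [x Ox|]; first by apply: derivableM; [exact: fi|exact: gi].
have := CkD oO (IH _ _ (CkS Cf) gk) (IH _ _ (CkS Cg) fk).
apply: eq_Ck => // x Ox.
by rewrite deriveM //; [exact: fi|exact: gi].
Qed.

Lemma CkZ m O (c : R) f : open O -> Ck m O f -> Ck m O (c *: f).
Proof. by move=> oO Cf; have := CkM oO (Ck_cst m O c) Cf; apply: eq_Ck. Qed.

Lemma Ck_sum m O (I : Type) (r : seq I) (F : I -> 'rV[R]_n -> R) : open O ->
  (forall i, Ck m O (F i)) -> Ck m O (\sum_(i <- r) F i).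
Proof.
move=> oO CF; elim: r => [|i r IH]; first by rewrite big_nil; exact: Ck_cst.
by rewrite big_cons; exact: CkD.
Qed.

Lemma iter_partial_rcons l i f :
  iter_partial (rcons l i) f = iter_partial l ('D_(basis_vec R i) f).
Proof. by rewrite /iter_partial foldr_rcons. Qed.

Lemma Cinfty_partial O f l : Cinfty O f -> Cinfty O (iter_partial l f).
Proof.
move=> Cf; elim/last_ind: l f Cf => // l i IH f Cf.
by rewrite iter_partial_rcons; apply: IH => m; have [_ /(_ i)[]] := Cf m.+1.
Qed.

Lemma Cinfty_smooth_on O f : Cinfty O f -> smooth_on O f.
Proof.
move=> Cf; exists (fun l => iter_partial l f); split=> // l x Ox.
have Cl := Cinfty_partial l Cf; split=> [|i]; first exact: Ck_cont (Cl 0%N) Ox.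
by have [_ /(_ i)[ld _]] := Cl 1%N; apply: derivableP; exact: ld.
Qed.

(** On an open set the family of derivatives that witnesses [smooth_on] can only
    be the family of iterated partial derivatives of [f]. *)
Lemma smooth_on_Cinfty O f : open O -> smooth_on O f -> Cinfty O f.
Proof.
move=> oO [d [<- dP]] m; elim: m [::] => [|m IH] l.
  by split=> // x /dP-/(_ l)[].
split=> [x /dP-/(_ l)[]//|i]; split=> [x /dP-/(_ l)[_ /(_ i)[]]//|].
apply: eq_Ck (IH (i :: l)) => // x /dP-/(_ l)[_ /(_ i)].
by move=> ?; rewrite derive_val.
Qed.

Lemma Cinfty_derivable O f x i : Cinfty O f -> O x -> derivable f x (basis_vec R i).
Proof. by move=> /(_ 1%N)[_ /(_ i)[fi _]]; exact: fi. Qed.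

Lemma Cinfty_cont O f x : Cinfty O f -> O x -> {for x, continuous f}.
Proof. by move=> /(_ 0%N); exact: Ck_cont. Qed.

Lemma eq_iter_partial O f g l x : open O -> (forall y, O y -> f y = g y) -> O x ->
  iter_partial l f x = iter_partial l g x.
Proof.
move=> oO fg; elim: l x => [|i l IH] x Ox; first exact: fg.
by apply: near_eq_derive; exact: near_open Ox.
Qed.

Lemma iter_partialD O f g l x : open O -> Cinfty O f -> Cinfty O g -> O x ->
  iter_partial l (f + g) x = iter_partial l f x + iter_partial l g x.
Proof.
move=> oO Cf Cg; elim: l x => [//|i l IH] x Ox.
transitivity ('D_(basis_vec R i) (iter_partial l f + iter_partial l g) x).
  by apply: near_eq_derive; exact: near_open Ox.
by rewrite deriveD //; apply: Cinfty_derivable Ox; exact: Cinfty_partial.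
Qed.

Lemma iter_partialZ O (c : R) f l x : open O -> Cinfty O f -> O x ->
  iter_partial l (c *: f) x = c * iter_partial l f x.
Proof.
move=> oO Cf; elim: l x => [//|i l IH] x Ox.
transitivity ('D_(basis_vec R i) (c *: iter_partial l f) x).
  by apply: near_eq_derive; exact: near_open Ox.
by rewrite deriveZ //; apply: Cinfty_derivable Ox; exact: Cinfty_partial.
Qed.

Lemma compact_bound (T : topologicalType) (f : T -> R) (L : set T) :
  compact L -> (forall x, L x -> {for x, continuous f}) ->
  exists2 B, 0 <= B & forall x, L x -> f x <= B.
Proof.
move=> cL cf; have [->|/set0P L0] := eqVneq L set0; first by exists 0.
have [|c _ fc] := compact_EVT_max L0 cL (f := f).
  by apply: continuous_in_subspaceT => x /set_mem; exact: cf.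
exists `|f c| => // x Lx; apply: le_trans (ler_norm _).
by apply: fc; rewrite inE.
Qed.

(** The Leibniz rule, in the weak form that an estimate of seminorms asks for:
    the derivatives of [h] are bounded on the compact set [C], and which
    derivatives of [f] occur depends on [l] only. Taking one derivative first
    splits d_i (h f) into (d_i h) f and h (d_i f), to which the induction
    hypothesis for [l] applies. *)
Lemma leibniz_bound O C h l : open O -> C `<=` O -> compact C -> Cinfty O h ->
  exists B (s : seq (seq 'I_n)), 0 <= B /\
    forall f, Cinfty O f -> forall x, C x ->
      `|iter_partial l (h * f) x| <= B * \sum_(l' <- s) `|iter_partial l' f x|.
Proof.
move=> oO CO cC; elim/last_ind: l h => [|l i IH] h Ch.
  have [|B B0 hB] := @compact_bound _ (fun x => `|h x|) _ cC.
    move=> x Cx; apply: (@continuous_comp _ _ _ h Num.norm).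
      exact: Cinfty_cont Ch (CO _ Cx).
    exact: norm_continuous.
  exists B, [:: [::]]; split=> // f _ x Cx.
  by rewrite big_seq1 /= normrM ler_wpM2r // hB.
have Cdh : Cinfty O ('D_(basis_vec R i) h) by exact: (Cinfty_partial [:: i] Ch).
have [B1 [s1 [B10 h1]]] := IH _ Cdh.
have [B2 [s2 [B20 h2]]] := IH _ Ch.
exists (B1 + B2), (s1 ++ [seq rcons l' i | l' <- s2]); split.
  exact: addr_ge0.
move=> f Cf x Cx; have Ox := CO _ Cx.
have Cdf : Cinfty O ('D_(basis_vec R i) f) by exact: (Cinfty_partial [:: i] Cf).
rewrite iter_partial_rcons.
have -> : iter_partial l ('D_(basis_vec R i) (h * f)) x =
    iter_partial l ('D_(basis_vec R i) h * f + h * 'D_(basis_vec R i) f) x.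
  apply: eq_iter_partial Ox => // y Oy.
  rewrite deriveM; [|exact: Cinfty_derivable Oy..].
  by rewrite addrC; congr (_ + _); rewrite mulrC.
rewrite (iter_partialD l oO _ _ Ox); [|by move=> m; apply: CkM..].
apply: le_trans (ler_normD _ _) _.
rewrite big_cat big_map /=.
under [X in _ <= _ * (_ + X)]eq_bigr do rewrite iter_partial_rcons.
set S1 := \sum_(j <- s1) _; set S2 := \sum_(j <- s2) _.
have S10 : 0 <= S1 by exact: sumr_ge0.
have S20 : 0 <= S2 by exact: sumr_ge0.
apply: le_trans (lerD (h1 _ Cf _ Cx) (h2 _ Cdf _ Cx)) _.
rewrite -/S1 -/S2; nra.
Qed.

End Calculus.

(** * A smooth plateau function on the line *)

Section Flat.
Variable R : realType.

(** The functions t^(-j) exp(-1/t), extended by 0 to t <= 0. Their span is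
    closed under differentiation ([is_derive_flat]), which makes exp(-1/t)
    smooth without any formula for its higher derivatives. *)
Definition flat (j : nat) (t : R) : R :=
  if 0 < t then t ^- j * expR (- t^-1) else 0.

Lemma flat_le0 j t : t <= 0 -> flat j t = 0.
Proof. by move=> t0; rewrite /flat ltNge t0. Qed.

Lemma flat_gt0 j t : 0 < t -> 0 < flat j t.
Proof. by move=> t0; rewrite /flat t0 mulr_gt0 ?expR_gt0 // invr_gt0 exprn_gt0. Qed.

(** From u^(j+2) <= (j+2)! exp(u) at u = 1/t. Quadratic decay at 0 gives
    derivative 0 there. *)
Lemma flat_le_quadratic j t : `|flat j t| <= (j.+2)`!%:R * t ^+ 2.
Proof.
have [t0|t0] := leP t 0; first by rewrite flat_le0 // normr0 mulr_ge0 ?sqr_ge0.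
rewrite (ger0_norm (ltW (flat_gt0 j t0))) /flat t0 expRN.
rewrite ler_pdivrMr ?expR_gt0 //.
have u0 : 0 <= t^-1 by rewrite invr_ge0 ltW.
have := expR_ge1Dxn j.+1 u0; set f := (_`!)%:R => H.
have f0 : 0 < f by rewrite ltr0n fact_gt0.
have : t ^- j.+2 / f <= expR t^-1.
  by rewrite -exprVn; apply: le_trans H; rewrite lerDr.
rewrite ler_pdivrMr // mulrC -(@ler_pM2r _ (t ^+ 2)) ?exprn_gt0 //.
rewrite -addn2 exprD invfM mulfVK ?expf_neq0 ?gt_eqF // => /le_trans; apply.
by rewrite mulrAC.
Qed.

Lemma is_derive_quadratic (f : R -> R) (C : R) :
  (forall t, `|f t| <= C * t ^+ 2) -> is_derive (0 : R) 1 f 0.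
Proof.
move=> fC.
have f0 : f 0 = 0.
  by apply/eqP; rewrite -normr_le0; apply: le_trans (fC 0) _; rewrite expr0n mulr0.
suff H : h^-1 *: (f (h *: 1 + 0) - f 0) @[h --> 0^'] --> (0 : R).
  by apply: DeriveDef; [apply/cvg_ex; exists 0|exact: cvg_lim H].
rewrite f0; apply: norm_cvg0.
have C0 : 0 <= C by have := fC 1; rewrite expr1n mulr1; apply: le_trans.
apply: (@squeeze_cvgr _ _ _ _ (cst 0) (fun h => C * `|h|)).
- near=> h; rewrite normr_ge0 /= addr0 subr0 [h *: 1]mulr1.
  have h0 : h != 0 by near: h; exact: nbhs_dnbhs_neq.
  rewrite [_ *: _]/(_ * _) normrM normfV ler_pdivrMl ?normr_gt0 //.
  by apply: le_trans (fC h) _; rewrite [leRHS]mulrCA -expr2 real_normK ?num_real.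
- exact: cvg_cst.
have : C * `|h| @[h --> (0 : R)^'] --> C * `|0 : R|.
  by apply: cvgM; [exact: cvg_cst|apply: cvg_norm; exact: cvg_within].
by rewrite normr0 mulr0.
Unshelve. all: by end_near. Qed.

Lemma is_derive_flat (j : nat) (t : R) :
  is_derive t 1 (flat j) (flat j.+2 t - j%:R * flat j.+1 t).
Proof.
have [t0|t0|->] := ltgtP t 0.
- have -> : flat j.+2 t - j%:R * flat j.+1 t = 0.
    by rewrite !flat_le0 ?ltW // mulr0 subr0.
  apply: (near_eq_is_derive (f := cst 0)).
    near=> s; rewrite flat_le0 // ltW //; near: s.
    exact: lt_nbhsl.
- pose V := (fun s : R => s^-1).
  have iV : is_derive t 1 V (- t ^- 2).
    have := @is_deriveV _ id t 1 1 (lt0r_neq0 t0) (is_derive_id _ _).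
    by rewrite [_ *: _]mulr1.
  have iE := is_derive1_comp (is_derive_expR _) (is_deriveN iV).
  have iX := is_deriveX j iV.
  apply: (near_eq_is_derive (f := V ^+ j * (expR \o (- V)))).
    near=> s; rewrite /flat ifT ?fctE -?exprVn //.
    by near: s; exact: lt_nbhsr.
  apply: is_derive_eq (is_deriveM iX iE) _; rewrite /flat t0 /= !fctE /V.
  have scalE (a b : R) : a *: b = a * b by [].
  rewrite -!exprVn !scalE; set v := t^-1; set w := expR _.
  by case: j {iX} => [|j] /=; rewrite ?exprS ?expr0; ring.
rewrite !flat_le0 // mulr0 subr0.
exact: is_derive_quadratic (flat_le_quadratic j).
Unshelve. all: by end_near. Qed.

Lemma flat0_homo (s t : R) : 0 < s -> s <= t -> flat 0 s <= flat 0 t.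
Proof.
move=> s0 st; have t0 := lt_le_trans s0 st.
by rewrite /flat s0 t0 !expr0 invr1 !mul1r ler_expR lerN2 lef_pV2.
Qed.

(** Composing [flat 0] with itself produces a plateau without division by a
    function: the inner [flat 0] vanishes for s <= 1/2, and for s >= 1 it is at
    least its value at 1/2, so that the argument of the outer one is
    nonpositive. *)
Definition plateau (s : R) : R :=
  (flat 0 1)^-1 * flat 0 (1 - (flat 0 2^-1)^-1 * flat 0 (s - 2^-1)).

Lemma plateau1 s : s <= 2^-1 -> plateau s = 1.
Proof.
move=> s1; rewrite /plateau [flat 0 (s - _)]flat_le0 ?subr_le0 // mulr0 subr0.
by rewrite mulVf // gt_eqF // flat_gt0.
Qed.

Lemma plateau0 s : 1 <= s -> plateau s = 0.
Proof.
move=> s1; rewrite /plateau [flat 0 (1 - _)]flat_le0 ?mulr0 // subr_le0.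
rewrite mulrC ler_pdivlMr ?flat_gt0 // mul1r.
apply: flat0_homo => //; lra.
Qed.

Lemma is_derive_lineP (n : nat) (f : 'rV[R]_n -> R) (x v : 'rV[R]_n) (d : R) :
  is_derive x v f d <-> is_derive (0 : R) 1 (fun t : R => f (t *: v + x)) d.
Proof.
have E : 'D_v f x = 'D_1 (fun t : R => f (t *: v + x)) (0 : R).
  rewrite /derive; set g1 := fun h => h^-1 *: _; set g2 := fun h => h^-1 *: _.
  suff -> : g1 = g2 by [].
  apply/funext => h; rewrite /g1 /g2 /=.
  by rewrite addr0 scale0r add0r [_%:A]mulr1.
split=> -[fd <-]; split; rewrite ?E //.
  by case: (derivable1P f x v) => H _; exact: H.
by case: (derivable1P f x v) => _ H; exact: H.
Qed.

(** Only the directional derivative of [f] is assumed to exist, so the chain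
    rule is applied along the line through [x] in the direction [v]. *)
Lemma is_derive_comp_line (n : nat) (phi : R -> R) (f : 'rV[R]_n -> R) x v (a b : R) :
  is_derive (f x) 1 phi a -> is_derive x v f b ->
  is_derive x v (phi \o f) (a * b).
Proof.
move=> dphi /is_derive_lineP df; apply/is_derive_lineP.
apply: (@is_derive1_comp _ phi (fun t : R => f (t *: v + x))).
by rewrite scale0r add0r.
Qed.

Lemma Ck_flat n m j (O : set 'rV[R]_n) f : open O -> Ck m O f -> Ck m O (flat j \o f).
Proof.
move=> oO; elim: m j f => [|m IH] j f Cf.
  split=> // x Ox; apply: continuous_comp; first exact: Ck_cont Cf Ox.
  apply/differentiable_continuous/derivable1_diffP.
  by case: (is_derive_flat j (f x)).
split=> [x Ox|i].
  apply: continuous_comp; first exact: Ck_cont Cf Ox.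
  apply/differentiable_continuous/derivable1_diffP.
  by case: (is_derive_flat j (f x)).
have [_ /(_ i)[fd fk]] := Cf.
have D x : O x -> is_derive x (basis_vec R i) (flat j \o f)
    ((flat j.+2 (f x) - j%:R * flat j.+1 (f x)) * 'D_(basis_vec R i) f x).
  move=> Ox; apply: is_derive_comp_line; first exact: is_derive_flat.
  by apply: derivableP; exact: fd.
split=> [x /D[]//|].
pose F := ((flat j.+2 \o f) + (- j%:R) *: (flat j.+1 \o f)) * 'D_(basis_vec R i) f.
apply: (@eq_Ck _ _ _ _ F) => //.
  by move=> x /D dx; rewrite derive_val /F !fctE scaleNr.
apply: CkM => //; apply: CkD => //; first by apply: IH; exact: CkS.
by apply: CkZ => //; apply: IH; exact: CkS.
Qed.

Lemma Ck_plateau n m (O : set 'rV[R]_n) f : open O -> Ck m O f -> Ck m O (plateau \o f).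
Proof.
move=> oO Cf.
have Ca g (a c : R) : Ck m O g -> Ck m O (fun x => a + c * g x).
  by move=> Cg; exact: CkD oO (Ck_cst _ _ a) (CkZ c oO Cg).
have := Ca _ 0 (flat 0 1)^-1 (Ck_flat 0 oO (Ca _ 1 (- (flat 0 2^-1)^-1)
   (Ck_flat 0 oO (Ca _ (- 2^-1) 1 Cf)))).
apply: eq_Ck => // x Ox; rewrite /= /plateau add0r mul1r mulNr.
by rewrite [- 2^-1 + _]addrC.
Qed.

End Flat.

(** * Smooth functions on charts and on open submanifolds *)

Section Charts.
Variables (R : realType) (n : nat).

(** The conditions on the atlas of a manifold that pass to open subsets.
    Paracompactness is left out because an open subset of a paracompact space
    need not be paracompact. *)
Record charted (M : premanifold R n) : Prop := IsCharted {
  ch_open : forall c : chart M, open (cdom c);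
  ch_inj : forall (c : chart M) x y,
    cdom c x -> cdom c y -> cmap c x = cmap c y -> x = y;
  ch_cont : forall (c : chart M) x, cdom c x -> {for x, continuous (cmap c)};
  ch_map_open : forall (c : chart M) (O : set M),
    open O -> O `<=` cdom c -> open (cmap c @` O) }.

Lemma manifold_charted (M : premanifold R n) : is_manifold M -> charted M.
Proof. by case=> *; split. Qed.

Section ChartedM.
Variables (M : premanifold R n) (hM : charted M).
Implicit Types (c : chart M) (O P : set M) (f g : M -> R).

Definition chart_image c O : set 'rV[R]_n := cmap c @` (cdom c `&` O).

Lemma open_chart_image c O : open O -> open (chart_image c O).
Proof.
move=> oO; apply: (ch_map_open hM); last by move=> x [].
by apply: openI => //; exact: ch_open.
Qed.

Lemma chart_image_mem c O x : cdom c x -> O x -> chart_image c O (cmap c x).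
Proof. by move=> cx Ox; exists x. Qed.

Lemma local_rep_cmap c f x : cdom c x -> local_rep c f (cmap c x) = f x.
Proof.
move=> cx; rewrite /local_rep; case: pselect => [h|[]]; last by exists x.
case: (cid h) => /= y [cy yx]; congr f; exact: (ch_inj hM cy cx yx).
Qed.

Lemma local_rep_eq c O f g : (forall x, O x -> f x = g x) ->
  forall y, chart_image c O y -> local_rep c f y = local_rep c g y.
Proof. by move=> fg _ [x [cx Ox] <-]; rewrite !local_rep_cmap // fg. Qed.

Lemma smooth_in_chartP c O f : open O ->
  smooth_in_chart c O f <-> Cinfty (chart_image c O) (local_rep c f).
Proof.
move=> oO; split; last exact: Cinfty_smooth_on.
by apply: smooth_on_Cinfty; exact: open_chart_image.
Qed.

Lemma eq_smooth_in_chart c O f g : open O -> (forall x, O x -> f x = g x) ->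
  smooth_in_chart c O f -> smooth_in_chart c O g.
Proof.
move=> oO fg /smooth_in_chartP-/(_ oO) sf; apply/smooth_in_chartP => // m.
by apply: eq_Ck (sf m); [exact: open_chart_image|exact: local_rep_eq].
Qed.

Lemma sub_smooth_in_chart c O P f : open O -> open P -> P `<=` O ->
  smooth_in_chart c O f -> smooth_in_chart c P f.
Proof.
move=> oO oP PO /smooth_in_chartP-/(_ oO) sf; apply/smooth_in_chartP => // m.
by apply: sub_Ck (sf m) => _ [x [cx Px] <-]; apply: chart_image_mem => //; exact: PO.
Qed.

Lemma local_smooth_in_chart c O f : open O ->
  (forall x, cdom c x -> O x -> exists P, [/\ open P, P x & smooth_in_chart c P f]) ->
  smooth_in_chart c O f.
Proof.
move=> oO H; apply/smooth_in_chartP => // m; apply: local_Ck => _ [x [cx Ox] <-].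
have [P [oP Px /smooth_in_chartP-/(_ oP) sP]] := H x cx Ox.
by exists (chart_image c P) => //; exact: chart_image_mem.
Qed.

Lemma smooth_in_chartM c O f g : open O -> smooth_in_chart c O f ->
  smooth_in_chart c O g -> smooth_in_chart c O (f * g).
Proof.
move=> oO /smooth_in_chartP-/(_ oO) sf /smooth_in_chartP-/(_ oO) sg.
apply/smooth_in_chartP => // m.
apply: eq_Ck (CkM _ (sf m) (sg m)); [exact: open_chart_image| |exact: open_chart_image].
by move=> _ [x [cx Ox] <-]; rewrite !fctE !local_rep_cmap.
Qed.

Lemma smooth_in_chart_cst c O (a : R) : open O -> smooth_in_chart c O (cst a).
Proof.
move=> oO; apply/smooth_in_chartP => // m.
apply: eq_Ck (Ck_cst _ _ a); first exact: open_chart_image.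
by move=> _ [x [cx Ox] <-]; rewrite local_rep_cmap.
Qed.

End ChartedM.

Section Submanifold.
Variables (M : premanifold R n) (hM : charted M) (U : set M) (oU : open U).

Definition pt_of (x : M) (Ux : U x) : open_submanifold U := exist _ x (mem_set Ux).

Lemma val_in_sub (x : open_submanifold U) : U (val x).
Proof. exact: set_valP. Qed.

Lemma val_continuous : continuous (val : open_submanifold U -> M).
Proof. exact: initial_continuous. Qed.

Lemma open_preim_val (O : set M) : open O ->
  open ([set x | O (val x)] : set (open_submanifold U)).
Proof. by move=> oO; apply: open_comp oO => x _; exact: val_continuous. Qed.

Lemma open_image_val (O : set (open_submanifold U)) : open O ->
  open (val @` O : set M).
Proof.
move=> [P oP <-]; rewrite (_ : _ @` _ = P `&` U); first exact: openI.
apply/seteqP; split=> [_ [x Px <-]|x [Px Ux]]; first by split=> //; exact: val_in_sub.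
by exists (pt_of Ux).
Qed.

Lemma charted_sub : charted (open_submanifold U).
Proof.
split.
- by move=> c; apply: open_preim_val; exact: ch_open.
- by move=> c x y cx cy e; apply: val_inj; exact: (ch_inj hM) e.
- move=> c x cx; apply: (@continuous_comp (open_submanifold U) M _ val (@cmap _ _ M c)).
    exact: val_continuous.
  exact: ch_cont.
- move=> c O oO Oc.
  rewrite (_ : _ @` O = (@cmap _ _ M c) @` (val @` O)).
    apply: (ch_map_open hM); first exact: open_image_val.
    by move=> _ [x Ox <-]; exact: Oc.
  by rewrite -image_comp.
Qed.

Lemma chart_image_sub (c : chart M) (O : set M) :
  @chart_image (open_submanifold U) c [set x | O (val x)] = chart_image c (O `&` U).
Proof.
apply/seteqP; split=> [_ [x [cx Ox] <-]|_ [x [cx [Ox Ux]] <-]].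
  by exists (val x) => //; split=> //; split=> //; exact: val_in_sub.
by exists (pt_of Ux).
Qed.

(** The two representatives differ off the chart image of [U], where that over
    the submanifold is 0, but this image is open, so all derivatives agree on
    it. *)
Lemma local_rep_sub (c : chart M) (f : M -> R) (g : open_submanifold U -> R) O :
  (forall x : open_submanifold U, O (val x) -> g x = f (val x)) ->
  forall y, chart_image c (O `&` U) y ->
  @local_rep _ _ (open_submanifold U) c g y = local_rep c f y.
Proof.
move=> gf _ [x [cx [Ox Ux]] <-]; rewrite (local_rep_cmap hM) //.
rewrite (_ : cmap c x = @cmap _ _ (open_submanifold U) c (pt_of Ux)) //.
by rewrite (local_rep_cmap charted_sub) // gf.
Qed.

Lemma smooth_in_chart_sub (c : chart M) (f : M -> R) (g : open_submanifold U -> R) O :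
  open O -> (forall x : open_submanifold U, O (val x) -> g x = f (val x)) ->
  @smooth_in_chart _ _ (open_submanifold U) c [set x | O (val x)] g <->
  smooth_in_chart c (O `&` U) f.
Proof.
move=> oO gf; have oOU := openI oO oU.
have E := local_rep_sub (c := c) gf; split.
  move=> /(smooth_in_chartP charted_sub)-/(_ (open_preim_val oO)).
  rewrite chart_image_sub => H; apply/(smooth_in_chartP hM) => // m.
  by apply: eq_Ck (H m) => //; exact: (open_chart_image hM).
move=> /(smooth_in_chartP hM)-/(_ oOU) H.
apply/(smooth_in_chartP charted_sub); first exact: open_preim_val.
move=> m; rewrite chart_image_sub; apply: eq_Ck (H m); first exact: (open_chart_image hM).
by move=> y /E.
Qed.

Lemma compact_preim_val (L : set M) : compact L -> L `<=` U ->
  compact ([set x | L (val x)] : set (open_submanifold U)).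
Proof.
move=> cL LU F FF FL.
have [|x [Lx clx]] := cL (val @ F) _; first exact: FL.
exists (pt_of (LU _ Lx)); split=> //= A B FA.
rewrite nbhsE => -[B' [[V oV <-] Bx] BB].
have FA' : F (val @^-1` (val @` A : set M)) by apply: filterS FA => z Az; exists z.
have [y [[z Az zy] Vy]] := clx (val @` A) V FA' (open_nbhs_nbhs (conj oV Bx)).
by exists z; split=> //; apply: BB; move: Vy; rewrite -zy.
Qed.

Lemma compact_image_val (L : set (open_submanifold U)) : compact L ->
  compact (val @` L : set M).
Proof.
move=> cL; apply: continuous_compact cL; apply: continuous_subspaceT.
exact: val_continuous.
Qed.

(** Densities on the open submanifold and on the manifold thus obey the same
    transformation rule. *)
Lemma jacobian_sub (c c' : chart M) (x : open_submanifold U) : cdom c (val x) ->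
  cdom c' (val x) ->
  @jacobian_mx _ _ (open_submanifold U) c c' x = jacobian_mx c c' (val x).
Proof.
move=> cx c'x; apply/matrixP => i j; rewrite !mxE.
apply: near_eq_derive; apply: (@near_open _ _ (chart_image c (setT `&` U))).
- by apply: (open_chart_image hM); apply: openI => //; exact: openT.
- by move=> y yP; apply: (local_rep_sub _ yP).
- by apply: chart_image_mem => //; split=> //; exact: val_in_sub.
Qed.

End Submanifold.
End Charts.

(** * Bump functions on manifolds *)

Section Bump.
Variables (R : realType) (n : nat) (M : premanifold R n) (hM : is_manifold M).
Let chM := manifold_charted hM.

Lemma box_nbhs (O : set 'rV[R]_n) y : open O -> O y ->
  exists2 r : R, 0 < r &
    [set z : 'rV[R]_n | forall j, `[y 0 j - r, y 0 j + r]%classic (z 0 j)] `<=` O.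
Proof.
move=> oO Oy; have [e /= e0 eO] : nbhs_ball y O.
  by apply/nbhs_ballP; exact: open_nbhs_nbhs.
exists (e / 2); first by rewrite divr_gt0.
move=> z zB; apply: eO; split=> // i j; rewrite (ord1 i) -ball_normE /=.
have := zB j; rewrite /= in_itv /= => /andP[z1 z2].
rewrite ltr_norml; lra.
Qed.

Lemma Ck_sqdist m (O : set 'rV[R]_n) (F : 'I_n -> 'rV[R]_n -> R) (a : R) (b : 'I_n -> R) :
  open O -> (forall j, Ck m O (F j)) ->
  Ck m O (\sum_j (cst a * (F j + cst (- b j))) ^+ 2).
Proof.
move=> oO CF; apply: Ck_sum => // j; rewrite expr2.
suff H : Ck m O (cst a * (F j + cst (- b j))) by exact: CkM.
apply: CkM => //; first exact: Ck_cst.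
by apply: CkD => //; exact: Ck_cst.
Qed.

(** The inverse of the chart is continuous on the chart image, because charts
    are open maps, and the set in question is the image of [B] under it. *)
Lemma compact_chart_box (c : chart M) (U : set M) (B : set 'rV[R]_n) :
  open U -> compact B -> B `<=` chart_image c U ->
  compact [set x | cdom c x /\ U x /\ B (cmap c x)].
Proof.
move=> oU cB BU.
have [->|/set0P[x0 _]] := eqVneq [set x | cdom c x /\ U x /\ B (cmap c x)] set0.
  exact: compact0.
pose psi y := xget x0 [set x | cdom c x /\ U x /\ cmap c x = y].
have psiK x : cdom c x -> U x -> psi (cmap c x) = x.
  move=> cx Ux; apply: xget_unique => //= y [cy [_ /esym]].
  by move=> /(ch_inj chM cx cy).
rewrite (_ : [set x | _] = psi @` B).
  apply: continuous_compact cB; apply: continuous_in_subspaceT => y /set_mem By.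
  have [x [cx Ux] xy] := BU _ By; rewrite -xy => N.
  rewrite psiK // nbhsE => -[V [oV Vx] VN].
  have : nbhs (cmap c x) (chart_image c (U `&` V)).
    apply: open_nbhs_nbhs; split; first by apply: open_chart_image => //; exact: openI.
    exact: chart_image_mem.
  by apply: filterS => _ [z [cz [Uz Vz]] <-] /=; rewrite psiK //; exact: VN.
apply/seteqP; split=> [x [cx [Ux Bx]]|_ [y By <-]].
  by exists (cmap c x) => //; exact: psiK.
have [x [cx Ux] xy] := BU _ By; rewrite -xy psiK //=.
by rewrite xy.
Qed.

(** In a chart at [x0], [chi] is the plateau function of the sum of the squares of
    (y_j - y0_j) / r, where the cube of half-side r around y0 lies in the image
    of [U]. Off the cube some summand is at least 1. Off the chart domain [chi]
    is 0; it is smooth across the boundary because its support lies in the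
    compact set [K], whose complement is open. *)
Lemma bump (U : set M) (x0 : M) : open U -> U x0 ->
  exists (chi : M -> R) (K W : set M),
    [/\ compact K, K `<=` U & forall x, ~ K x -> chi x = 0] /\
    [/\ open W, W x0, W `<=` U & forall x, W x -> chi x = 1] /\
    forall c, smooth_in_chart c setT chi.
Proof.
move=> oU Ux0; have [c cx0] := cdom_cover hM x0.
pose y0 := cmap c x0.
have [r r0 rO] := box_nbhs (open_chart_image chM oU) (chart_image_mem cx0 Ux0).
pose B := [set z : 'rV[R]_n | forall j, `[y0 0 j - r, y0 0 j + r]%classic (z 0 j)].
pose K := [set x | cdom c x /\ U x /\ B (cmap c x)].
have cK : compact K.
  apply: compact_chart_box => //.
  exact: (@rV_compact R n (fun j => `[y0 0 j - r, y0 0 j + r]%classic)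
           (fun j => @segment_compact _ _ _)).
pose q x := \sum_j (r^-1 * (cmap c x 0 j - y0 0 j)) ^+ 2.
pose chi x := if pselect (cdom c x) then plateau (q x) else 0.
have chiE x : cdom c x -> chi x = plateau (q x).
  by rewrite /chi; case: pselect.
have clK : closed K by apply: compact_closed cK; exact: manifold_hausdorff.
have chi0 x : ~ K x -> chi x = 0.
  rewrite /chi; case: pselect => // cx nK; apply: plateau0.
  have : ~ B (cmap c x).
    move=> Bx; apply: nK; split=> //; split=> //.
    have [z [cz Uz] zx] := rO _ Bx.
    by rewrite -(ch_inj chM cz cx zx).
  (* One coordinate outside [y0_j - r, y0_j + r] makes the sum at least 1. *)
  move=> /existsNP[j]; rewrite /= in_itv /= => nB.
  rewrite /q (bigD1 j) //= -[leLHS]addr0 lerD //; last first.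
    by apply: sumr_ge0 => i _; exact: sqr_ge0.
  have : 1 <= `|r^-1 * (cmap c x 0 j - y0 0 j)|.
    rewrite normrM gtr0_norm ?invr_gt0 // [leRHS]mulrC ler_pdivlMr // mul1r.
    rewrite leNgt; apply/negP; rewrite ltr_norml => H; apply: nB; lra.
  by rewrite -[X in _ -> _ <= X]real_normK ?num_real // => ?; rewrite expr_ge1.
have oc : open (cdom c) by exact: cdom_open.
exists chi, K, (interior [set x | U x /\ chi x = 1]); split.
  by split=> // x [_ []].
split.
  split=> [||x /interior_subset[]//|x /interior_subset[]//]; first exact: open_interior.
  have qc : {for x0, continuous q}.
    pose F j (y : 'rV[R]_n) : R := y 0 j.
    have -> : q = (\sum_j (cst r^-1 * (F j + cst (- y0 0 j))) ^+ 2) \o cmap c.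
      by apply/funext => x; rewrite /q /= fct_sumE; apply: eq_bigr => j _; rewrite !fctE expr2.
    apply: continuous_comp; first exact: (ch_cont chM).
    apply: (@Ck_cont _ _ 0 setT) => //; apply: Ck_sqdist => [|j]; first exact: openT.
    by split=> // y _; exact: coord_continuous.
  have q0 : q x0 = 0.
    by apply: big1 => j _; rewrite subrr mulr0 expr0n.
  have : \forall x \near x0, q x <= 2^-1.
    apply: (qc [set t | t <= 2^-1]); rewrite q0.
    near=> t; rewrite /= ltW //; near: t; apply: lt_nbhsl; lra.
  move=> qx; near=> x; split; near: x; first exact: open_nbhs_nbhs.
  near=> x; rewrite chiE; first by apply: plateau1; near: x.
  by near: x; exact: open_nbhs_nbhs.
move=> c'; apply: (local_smooth_in_chart chM) => [|x _ _]; first exact: openT.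
have [cx|cx] := pselect (cdom c x); last first.
  exists (~` K); split; [by rewrite openC| by move=> [] |].
  apply: (eq_smooth_in_chart chM (f := cst 0)); first by rewrite openC.
    by move=> z /chi0.
  by apply: (smooth_in_chart_cst chM); rewrite openC.
exists (cdom c); split=> //.
suff H : smooth_in_chart c' (cdom c) (@plateau R \o q).
  by apply: (eq_smooth_in_chart chM _ _ H) => // z /chiE.
apply/(smooth_in_chartP chM) => // m.
have oi := open_chart_image (c := c') chM oc.
pose F j := local_rep c' (fun x => cmap c x 0 j).
apply: (@eq_Ck _ _ _ _ (@plateau R \o \sum_j (cst r^-1 * (F j + cst (- y0 0 j))) ^+ 2)) => //.
  move=> _ [z [c'z cz] <-]; rewrite (local_rep_cmap chM) //= /q fct_sumE.
  by congr plateau; apply: eq_bigr => j _; rewrite !fctE /F (local_rep_cmap chM) // expr2.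
apply: Ck_plateau => //; apply: Ck_sqdist => // j.
by have /(smooth_in_chartP chM)-/(_ oc) := transition_smooth hM c' c j; apply.
Unshelve. all: by end_near. Qed.

End Bump.

(** * Continuous seminorms *)

Section Csn.
Variables (R : realType) (k : scalar_kind).
Implicit Types A B : lcs R k.

Lemma sabs1 : sabs (1 : scalars R k) = 1.
Proof. by case: k; rewrite /sabs /= ?expr0n /= ?expr1n addr0 sqrtr1. Qed.

Lemma sabsN1 : sabs (-1 : scalars R k) = 1.
Proof.
by case: k; rewrite /sabs /= ?oppr0 ?expr0n /= ?sqrrN ?expr1n addr0 sqrtr1.
Qed.

Lemma seminorm0 A (p : A -> R) : is_seminorm p -> p 0 = 0.
Proof. by move=> [_ pZ]; rewrite -(scale0r (0 : A)) pZ sabs0 mul0r. Qed.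

Lemma seminorm_ge0 A (p : A -> R) x : is_seminorm p -> 0 <= p x.
Proof.
move=> ps; have [pD pZ] := ps; have := pD x (-1 *: x).
rewrite pZ sabsN1 mul1r scaleN1r subrr (seminorm0 ps); lra.
Qed.

(** Homogeneity of the supremum holds as an inequality; applied to the inverse of
    the scalar it gives the reverse one. *)
Lemma sup_seminorm (V : lmodType (scalars R k)) (T : Type) (D : set T) (F : T -> V -> R) :
  (forall x, D x -> is_seminorm (F x)) ->
  (forall v, has_ubound [set F x v | x in D]) ->
  is_seminorm (fun v => sup [set F x v | x in D]).
Proof.
move=> Fs Fb; have [->|/set0P[x0 Dx0]] := eqVneq D set0.
  have E v : sup [set F x v | x in set0] = 0 by rewrite image_set0 sup0.
  by split=> [v w|a v]; rewrite !E ?addr0 ?mulr0.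
have ne v : [set F x v | x in D] !=set0 by exists (F x0 v), x0.
have le v x : D x -> F x v <= sup [set F y v | y in D].
  by move=> Dx; apply: sup_upper_bound; [split|exists x].
have sZ a v : sup [set F x (a *: v) | x in D] <= sabs a * sup [set F x v | x in D].
  apply: ge_sup => // _ [x Dx <-]; rewrite (Fs x Dx).2 ler_wpM2l ?sabs_ge0 //.
  exact: le.
split=> [v w|a v].
  apply: ge_sup => // _ [x Dx <-]; apply: le_trans ((Fs x Dx).1 v w) _.
  by rewrite lerD // le.
apply/eqP; rewrite eq_le sZ /=; have [->|a0] := eqVneq a 0.
  rewrite sabs0 mul0r; apply: le_trans (le _ _ Dx0).
  by rewrite (Fs _ Dx0).2 sabs0 mul0r.
have := sZ a^-1 (a *: v); rewrite scalerA mulVf // scale1r => /(ler_wpM2l (sabs_ge0 a)).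
by rewrite mulrA -sabsM mulfV // sabs1 mul1r.
Qed.

Lemma csn_ge0 A (p : A -> R) x : csn p -> 0 <= p x.
Proof. by case=> /seminorm_ge0. Qed.

Lemma csn_gen A (p : A -> R) : is_seminorm p -> lcs_gen p -> csn p.
Proof.
move=> ps pg; split=> //; exists 1%N, (fun=> 1), (fun=> p); split=> // x.
by rewrite big_ord1 mul1r.
Qed.

Lemma csn0 A : csn (fun _ : A => 0 : R).
Proof.
split; first by split=> *; rewrite ?addr0 ?mulr0.
by exists 0%N, (fun=> 0), (fun=> fun=> 0); split=> // x; rewrite big_ord0.
Qed.

Lemma csn_sum A (I : Type) (r : seq I) (p : I -> A -> R) :
  (forall i, csn (p i)) -> csn (fun x => \sum_(i <- r) p i x).
Proof.
move=> pc; elim: r => [|i r IH].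
  by have := csn0 A; congr csn; apply/funext => x; rewrite big_nil.
by have := csnD (pc i) IH; congr csn; apply/funext => x; rewrite big_cons.
Qed.

(** The index type [T] allows for an estimate that only holds for some pairs of
    vectors, such as the sections supported in a fixed compact set and their
    extensions. Coefficients in [csn] may be negative, hence the absolute values
    and the nonnegativity of the generators. *)
Lemma csn_dominate A B (T : Type) (f : T -> B) (g : T -> A) :
  (forall p : B -> R, lcs_gen p -> forall x, 0 <= p x) ->
  (forall p : B -> R, lcs_gen p -> exists2 r, csn r & forall t, p (f t) <= r (g t)) ->
  forall q : B -> R, csn q -> exists2 r, csn r & forall t, q (f t) <= r (g t).
Proof.
move=> p0 H q [_ [m [C [p [pg qp]]]]].
have /choice[r rP] : forall i, exists r : A -> R, csn r /\
    ((i < m)%N -> forall t, p i (f t) <= r (g t)).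
  move=> i; have [im|im] := boolP (i < m)%N.
    by have [r rc pr] := H _ (pg i im); exists r.
  by exists (fun=> 0); split => //; exact: csn0.
exists (fun x => \sum_(i < m) `|C i| * r i x).
  by apply: csn_sum => i; apply: csnZ => //; case: (rP i).
move=> t; apply: le_trans (qp _) _; apply: ler_sum => i _.
apply: (@le_trans _ _ (`|C i| * p i (f t))).
  by rewrite ler_wpM2r ?ler_norm // p0 //; exact: pg.
by rewrite ler_wpM2l //; case: (rP i) => _; exact.
Qed.

Lemma linear_map0 A B (f : A -> B) :
  (forall a x y, f (a *: x + y) = a *: f x + f y) -> f 0 = 0.
Proof. by move=> fl; have := fl (-1) 0 0; rewrite scaler0 addr0 scaleN1r addNr. Qed.

Lemma comp_seminorm A B (f : A -> B) (q : B -> R) :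
  (forall a x y, f (a *: x + y) = a *: f x + f y) -> is_seminorm q ->
  is_seminorm (q \o f).
Proof.
move=> fl [qD qZ]; have f0 := linear_map0 fl.
split=> [x y|a x] /=; first by rewrite -[x]scale1r fl !scale1r.
by have := fl a x 0; rewrite !addr0 f0 addr0 => ->.
Qed.

Lemma cont_linear_dominated A B (f : A -> B) :
  (forall a x y, f (a *: x + y) = a *: f x + f y) ->
  (forall p : B -> R, lcs_gen p -> forall x, 0 <= p x) ->
  (forall p : B -> R, lcs_gen p -> exists2 r, csn r & forall x, p (f x) <= r x) ->
  cont_linear f.
Proof.
move=> fl p0 H; split=> // q qc.
have [r rc qr] := csn_dominate p0 (g := id) H qc.
by apply: csn_le rc qr; apply: comp_seminorm => //; case: qc.
Qed.

Lemma cont_linear_comp A B (C : lcs R k) (f : A -> B) (g : B -> C) :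
  cont_linear f -> cont_linear g -> cont_linear (g \o f).
Proof.
move=> [fl fc] [gl gc]; split=> [a x y|q qc]; first by rewrite /= fl gl.
by have := fc _ (gc _ qc).
Qed.

Lemma clinP A B (f : clin A B) : cont_linear f.
Proof. by have /asboolP := clin_funP f. Qed.

Lemma to_clinE A B (f : A -> B) : cont_linear f -> to_clin f = f :> (A -> B).
Proof. by move=> fc; rewrite /to_clin -[LHS]/(val _) insubdK //; exact/asboolP. Qed.

End Csn.

(** * The seminorms of the space of smooth sections *)

Section SectionSeminorm.
Variables (R : realType) (k : scalar_kind) (n : nat) (M : premanifold R n).
Variables (hM : charted M) (E : prebundle k M) (oE : forall i : triv E, open (tdom i)).
Implicit Types (c : chart M) (i : triv E) (L : set M) (l : seq 'I_n) (a : 'I_(rank E)).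
Implicit Types (s : section_type E).

Definition coord_partial (part : scalars R k -> R) c i l a s (x : M) : R :=
  iter_partial l (local_rep c (part \o Defs.coord i a s)) (cmap c x).

Lemma section_smooth s : smooth_section s.
Proof. by have /asboolP := section_funP s. Qed.

Lemma Cinfty_coord c i a s :
  Cinfty (chart_image c (tdom i)) (local_rep c (@sRe R k \o Defs.coord i a s)) /\
  Cinfty (chart_image c (tdom i)) (local_rep c (@sIm R k \o Defs.coord i a s)).
Proof.
by have [s1 s2] := section_smooth s c i a; split; apply/(smooth_in_chartP hM).
Qed.

Definition hypot (a b : R) := Num.sqrt (a ^+ 2 + b ^+ 2).

Lemma hypot_le (a b : R) : hypot a b <= `|a| + `|b|.
Proof.
rewrite -[leRHS]ger0_norm ?addr_ge0 // -sqrtr_sqr ler_wsqrtr // sqrrD.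
by rewrite !real_normK ?num_real // addrAC lerDl mulrn_wge0 // mulr_ge0.
Qed.

Lemma le_hypotl (a b : R) : `|a| <= hypot a b.
Proof. by rewrite -sqrtr_sqr ler_wsqrtr // lerDl sqr_ge0. Qed.

Lemma le_hypotr (a b : R) : `|b| <= hypot a b.
Proof. by rewrite -sqrtr_sqr ler_wsqrtr // lerDr sqr_ge0. Qed.

Lemma hypotD (a b c d : R) : hypot (a + c) (b + d) <= hypot a b + hypot c d.
Proof.
have h0 x y : 0 <= hypot x y by exact: sqrtr_ge0.
have hE x y : hypot x y ^+ 2 = x ^+ 2 + y ^+ 2.
  by rewrite sqr_sqrtr // addr_ge0 ?sqr_ge0.
rewrite -(ler_pXn2r (ltn0Sn 1)) ?nnegrE ?addr_ge0 //.
rewrite sqrrD !hE.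
suff : a * c + b * d <= hypot a b * hypot c d by rewrite mulr2n; lra.
apply: le_trans (ler_norm _) _.
rewrite -(ler_pXn2r (ltn0Sn 1)) ?nnegrE ?mulr_ge0 //.
rewrite real_normK ?num_real // exprMn !hE.
have := sqr_ge0 (a * d - b * c); lra.
Qed.

Definition partial_norm c i l a s (x : M) : R :=
  hypot (coord_partial (@sRe R k) c i l a s x)
    (coord_partial (@sIm R k) c i l a s x).

Lemma section_seminormE c i L l a s : section_seminorm c i L l a s =
  sup [set partial_norm c i l a s x | x in L].
Proof. by []. Qed.

Lemma section_seminorm_le c i L l a s (B : R) : 0 <= B ->
  (forall x, L x -> partial_norm c i l a s x <= B) ->
  section_seminorm c i L l a s <= B.
Proof.
move=> B0 H; rewrite section_seminormE; have [->|/set0P[x Lx]] := eqVneq L set0.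
  by rewrite image_set0 sup0.
apply: ge_sup; first by exists (partial_norm c i l a s x), x.
by move=> _ [y Ly <-]; exact: H.
Qed.

(** Unbounded sets have supremum 0 by convention, so that a derivative is bounded
    by the seminorm only because it is continuous on the compact set. *)
Lemma section_seminorm_ub c i L l a s : compact L -> L `<=` cdom c `&` tdom i ->
  has_ubound [set partial_norm c i l a s x | x in L].
Proof.
move=> cL LO.
have dc y : L y -> {for y, continuous (coord_partial (@sRe R k) c i l a s)} /\
    {for y, continuous (coord_partial (@sIm R k) c i l a s)}.
  move=> /LO[cy iy]; have [C1 C2] := Cinfty_coord c i a s.
  have cc := ch_cont hM cy.
  by split; (apply: continuous_comp; first exact: cc);
    apply: Cinfty_cont (chart_image_mem cy iy); exact: Cinfty_partial.
have nc y : L y -> {for y, continuous (fun y => `|coord_partial (@sRe R k) c i l a s y|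
    + `|coord_partial (@sIm R k) c i l a s y|)}.
  move=> /dc[d1 d2].
  have norm_at (f : M -> R) : {for y, continuous f} -> {for y, continuous (fun y => `|f y|)}.
    by move=> fc; apply: (@continuous_comp _ _ _ f Num.norm) => //; exact: norm_continuous.
  exact: continuousD (norm_at _ d1) (norm_at _ d2).
have [B _ HB] := compact_bound cL nc.
by exists B => _ [y Ly <-]; apply: le_trans (hypot_le _ _) _; exact: HB.
Qed.

Lemma section_seminorm_ge c i L l a s x : compact L -> L `<=` cdom c `&` tdom i -> L x ->
  partial_norm c i l a s x <= section_seminorm c i L l a s.
Proof.
move=> cL LO Lx; apply: sup_upper_bound; last by exists x.
split; last exact: section_seminorm_ub.
by exists (partial_norm c i l a s x), x.
Qed.

Lemma section_seminorm_ge0 c i L l a s : 0 <= section_seminorm c i L l a s.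
Proof.
rewrite section_seminormE; set S := [set _ | _ in _].
have [[[_ [x Lx _]] ub]|/sup_out->//] := pselect (has_sup S).
apply: (@le_trans _ _ (partial_norm c i l a s x)).
  exact: sqrtr_ge0.
apply: sup_upper_bound; last by exists x.
by split=> //; exists (partial_norm c i l a s x), x.
Qed.

Lemma coord_partial_linear c i l a s t (z : scalars R k) x : cdom c x -> tdom i x ->
  coord_partial (@sRe R k) c i l a (z *: s + t) x =
     sRe z * coord_partial (@sRe R k) c i l a s x
     - sIm z * coord_partial (@sIm R k) c i l a s x
     + coord_partial (@sRe R k) c i l a t x /\
  coord_partial (@sIm R k) c i l a (z *: s + t) x =
     sRe z * coord_partial (@sIm R k) c i l a s x
     + sIm z * coord_partial (@sRe R k) c i l a s x
     + coord_partial (@sIm R k) c i l a t x.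
Proof.
move=> cx ix; have oi := open_chart_image hM (c := c) (oE i).
have cE y : Defs.coord i a (z *: s + t) y = z * Defs.coord i a s y + Defs.coord i a t y.
  by rewrite /Defs.coord linearP !mxE.
have [s1 s2] := Cinfty_coord c i a s; have [t1 t2] := Cinfty_coord c i a t.
have lin (u v : R) f g h (F : M -> R) :
   Cinfty (chart_image c (tdom i)) (local_rep c f) ->
   Cinfty (chart_image c (tdom i)) (local_rep c g) ->
   Cinfty (chart_image c (tdom i)) (local_rep c h) ->
   (forall y, F y = u * f y + v * g y + h y) ->
   iter_partial l (local_rep c F) (cmap c x) =
     u * iter_partial l (local_rep c f) (cmap c x)
      + v * iter_partial l (local_rep c g) (cmap c x)
      + iter_partial l (local_rep c h) (cmap c x).
  move=> Cf Cg Ch FE.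
  have xi := chart_image_mem cx ix.
  have CZ (w : R) e : Cinfty (chart_image c (tdom i)) e ->
      Cinfty (chart_image c (tdom i)) (w *: e).
    by move=> Ce m; exact: CkZ.
  rewrite (@eq_iter_partial _ _ _ _
    (u *: local_rep c f + v *: local_rep c g + local_rep c h) _ _ oi _ xi); last first.
    by move=> _ [y [cy _] <-]; rewrite !fctE !(local_rep_cmap hM).
  rewrite (iter_partialD _ oi _ Ch xi); last by move=> m; apply: CkD => //; exact: CZ.
  rewrite (iter_partialD _ oi _ _ xi); [|exact: CZ..].
  by rewrite !(iter_partialZ _ _ oi _ xi).
split; rewrite /coord_partial.
  rewrite -mulNr; apply: lin => // y; rewrite /= cE sReD sReM; ring.
apply: lin => // y; rewrite /= cE sImD sImM; ring.
Qed.

Lemma hypotM (p q a b : R) : hypot (p * a - q * b) (p * b + q * a) = hypot p q * hypot a b.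
Proof. by rewrite /hypot -sqrtrM ?addr_ge0 ?sqr_ge0 //; congr Num.sqrt; ring. Qed.

Lemma sReN1 : sRe (-1 : scalars R k) = -1. Proof. by case: k. Qed.
Lemma sImN1 : sIm (-1 : scalars R k) = 0. Proof. by case: k => //=; rewrite oppr0. Qed.
Lemma sRe1 : sRe (1 : scalars R k) = 1. Proof. by case: k. Qed.
Lemma sIm1 : sIm (1 : scalars R k) = 0. Proof. by case: k. Qed.

Lemma section_seminormP c i L l a : compact L -> L `<=` cdom c `&` tdom i ->
  is_seminorm (section_seminorm c i L l a : Gamma E -> R).
Proof.
move=> cL LO.
apply: (@sup_seminorm _ _ _ _ L (fun x (s : section_type E) =>
  partial_norm c i l a s x)); last first.
  by move=> s; exact: section_seminorm_ub.
move=> x /LO[cx ix]; split=> [s t|z s].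
  have := coord_partial_linear l a s t 1 cx ix.
  rewrite scale1r /partial_norm sRe1 sIm1 !mul0r !mul1r subr0 addr0 => -[-> ->].
  exact: hypotD.
have := coord_partial_linear l a s 0 z cx ix.
(* Linearity at -1 *: 0 + 0 shows that the derivatives of the zero section vanish. *)
have [] := coord_partial_linear l a 0 0 (-1) cx ix.
rewrite scaler0 !addr0 sReN1 sImN1 !mul0r !mulN1r subr0 addr0 !addNr => -> ->.
by rewrite /partial_norm !addr0 => -[-> ->]; rewrite hypotM.
Qed.

Lemma csn_section_seminorm c i L l a : compact L -> L `<=` cdom c `&` tdom i ->
  csn (section_seminorm c i L l a : Gamma E -> R).
Proof.
move=> cL LO; apply: csn_gen; first exact: section_seminormP.
by exists c, i, L, l, a.
Qed.

End SectionSeminorm.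

(** * Extension by zero of smooth sections *)

Section Transfer.
Variables (R : realType) (k : scalar_kind) (n : nat) (M : premanifold R n).
Variables (hM : charted M) (hausM : hausdorff_space M) (U : set M) (oU : open U).
Variables (chi : M -> R) (chis : forall c, smooth_in_chart c setT chi).
Variables (K : set M) (cK : compact K) (KU : K `<=` U).
Let clK : closed K := compact_closed hausM cK.
Let hU := charted_sub hM oU.

Definition ext_fun (g : open_submanifold U -> R) (x : M) : R :=
  match pselect (U x) with left h => g (pt_of h) | right _ => 0 end.

Lemma pt_of_val (x : open_submanifold U) (h : U (val x)) : pt_of h = x.
Proof. exact: val_inj. Qed.

Lemma ext_fun_val g (x : open_submanifold U) : ext_fun g (val x) = g x.
Proof.
rewrite /ext_fun; case: pselect => [h|]; first by rewrite pt_of_val.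
by case; exact: val_in_sub.
Qed.

Definition mult_ext (f : M -> R) (g : open_submanifold U -> R) :=
  (forall x : open_submanifold U, f (val x) = chi (val x) * g x) /\
  (forall x, ~ K x -> f x = 0).

Lemma mult_extE f g x : mult_ext f g -> U x -> f x = (chi * ext_fun g) x.
Proof. by move=> [fg _] Ux; have := fg (pt_of Ux); rewrite -ext_fun_val. Qed.

Lemma smooth_ext_fun (c : chart M) O g : open O ->
  @smooth_in_chart _ _ (open_submanifold U) c [set x | O (val x)] g ->
  smooth_in_chart c (O `&` U) (ext_fun g).
Proof.
move=> oO; apply: (iffLR (smooth_in_chart_sub hM oU c oO _)) => x _.
by rewrite ext_fun_val.
Qed.

(** The open sets [U] and the complement of [K] cover the manifold; [f] is
    chi g on the former and 0 on the latter. *)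
Lemma smooth_mult_ext (c : chart M) O f g : open O -> mult_ext f g ->
  @smooth_in_chart _ _ (open_submanifold U) c [set x | O (val x)] g ->
  smooth_in_chart c O f.
Proof.
move=> oO fg gs; apply: (local_smooth_in_chart hM) => // x cx Ox.
have oOU := openI oO oU.
have [Kx|nKx] := pselect (K x).
  exists (O `&` U); split=> //; first by split=> //; exact: KU.
  apply: (eq_smooth_in_chart hM (f := chi * ext_fun g)) => //.
    by move=> y [_ Uy]; rewrite (mult_extE fg).
  apply: (smooth_in_chartM hM) => //; last exact: smooth_ext_fun.
  by apply: (sub_smooth_in_chart hM) (chis c) => //; exact: openT.
have oOK : open (O `&` ~` K) by apply: openI => //; rewrite openC.
exists (O `&` ~` K); split=> //.
apply: (eq_smooth_in_chart hM (f := cst 0)) => //.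
  by move=> y [_ nKy]; rewrite fg.2.
exact: (smooth_in_chart_cst hM).
Qed.

(** Off [K] the function [f] vanishes on an open set; on the compact set
    [L `&` K] the Leibniz rule bounds its derivatives by those of [g], with
    constants that do not depend on [f] and [g]. *)
Lemma mult_ext_bound (c : chart M) (O L : set M) l : open O -> compact L ->
  L `<=` cdom c `&` O ->
  exists B (s : seq (seq 'I_n)), 0 <= B /\
    forall f g, mult_ext f g ->
      @smooth_in_chart _ _ (open_submanifold U) c [set x | O (val x)] g ->
      forall x, L x ->
        (~ K x -> iter_partial l (local_rep c f) (cmap c x) = 0) /\
        (K x -> `|iter_partial l (local_rep c f) (cmap c x)| <=
           B * \sum_(l' <- s) `|iter_partial l'
              (@local_rep _ _ (open_submanifold U) c g) (cmap c x)|).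
Proof.
move=> oO cL LO; have oOU := openI oO oU.
have oi := open_chart_image hM (c := c) oOU.
have cLK : compact (cmap c @` (L `&` K)).
  apply: continuous_compact; last by apply: compact_closedI.
  by apply: continuous_in_subspaceT => x /set_mem[/LO[cx _] _]; exact: ch_cont.
have LKi : cmap c @` (L `&` K) `<=` chart_image c (O `&` U).
  by move=> _ [x [/LO[cx Ox] /KU Ux] <-]; exact: chart_image_mem.
have Cchi : Cinfty (chart_image c (O `&` U)) (local_rep c chi).
  apply/(smooth_in_chartP hM) => //.
  by apply: (sub_smooth_in_chart hM) (chis c) => //; exact: openT.
have [B [s [B0 H]]] := leibniz_bound l oi LKi cLK Cchi.
exists B, s; split=> // f g fg gs x Lx; have [cx Ox] := LO _ Lx; split=> [nKx|Kx].
  have oOK : open (O `&` ~` K) by apply: openI => //; rewrite openC.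
  rewrite (@eq_iter_partial _ _ (chart_image c (O `&` ~` K)) _ (0 *: cst 0)).
  - rewrite (@iter_partialZ _ _ setT) ?mul0r //; first exact: openT.
    by move=> m; exact: Ck_cst.
  - exact: open_chart_image.
  - by move=> _ [y [cy [_ nKy]] <-]; rewrite (local_rep_cmap hM) // fg.2 // fctE /= scaler0.
  - exact: chart_image_mem.
have xi : chart_image c (O `&` U) (cmap c x) by apply: chart_image_mem => //; split=> //; exact: KU.
rewrite (@eq_iter_partial _ _ _ _ (local_rep c chi * local_rep c (ext_fun g)) _ _ oi _ xi).
  have Cg : Cinfty (chart_image c (O `&` U)) (local_rep c (ext_fun g)).
    by apply/(smooth_in_chartP hM) => //; exact: smooth_ext_fun.
  apply: le_trans (H _ Cg _ _) _; first by exists x.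
  rewrite ler_wpM2l //; apply: ler_sum => l' _.
  suff -> : iter_partial l' (local_rep c (ext_fun g)) (cmap c x) = iter_partial l'
    (@local_rep _ _ (open_submanifold U) c g) (cmap c x) by [].
  apply: (eq_iter_partial l' oi _ xi) => y yi; apply/esym.
  by apply: (local_rep_sub hM oU _ yi) => z _; rewrite ext_fun_val.
move=> _ [y [cy [_ Uy]] <-].
by rewrite !fctE !(local_rep_cmap hM) // (mult_extE fg).
Qed.

Variables (F : prebundle k M) (oF : forall i : triv F, open (tdom i)).
Variables (fib : open_submanifold U -> lmodType (scalars R k))
  (tm : forall (i : triv F) x, {linear fib x -> 'rV[scalars R k]_(rank F)}).

(** A bundle over [U] with the rank and the trivialization domains of [F] over
    [M]. Both the restriction of a bundle and the density bundle of a
    restriction are convertible to this form, although the latter is not the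
    restriction of a density bundle: its fibres refer to densities on [U]. *)
Definition over_sub : prebundle k (open_submanifold U) :=
  @PreBundle R k n (open_submanifold U) (rank F) fib (triv F)
    (fun i => [set x | tdom i (val x)]) tm.
Local Notation G := over_sub.

Lemma over_sub_open (i : triv G) : open (tdom i).
Proof. exact: open_preim_val (oF i). Qed.

Definition section_mult_ext (s : raw_section F) (t : raw_section G) :=
  (forall (i : triv F) a (x : open_submanifold U),
     Defs.coord i a s (val x) = of_real k (chi (val x)) * @Defs.coord _ _ _ _ G i a t x) /\
  (forall x, ~ K x -> s x = 0).

Lemma sRe_of_real (a : R) (z : scalars R k) : sRe (of_real k a * z) = a * sRe z.
Proof. by rewrite sReM /of_real; case: k z => //= z; rewrite mul0r subr0. Qed.

Lemma sIm_of_real (a : R) (z : scalars R k) : sIm (of_real k a * z) = a * sIm z.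
Proof. by rewrite sImM /of_real; case: k z => //= z; rewrite ?mulr0 ?mul0r addr0. Qed.

Lemma section_mult_ext_parts s t (i : triv F) a : section_mult_ext s t ->
  mult_ext (@sRe R k \o Defs.coord i a s) (@sRe R k \o @Defs.coord _ _ _ _ G i a t) /\
  mult_ext (@sIm R k \o Defs.coord i a s) (@sIm R k \o @Defs.coord _ _ _ _ G i a t).
Proof.
move=> [st s0]; split; split=> x /=; rewrite ?st ?sRe_of_real ?sIm_of_real // => /s0 sx0;
  by rewrite /Defs.coord sx0 linear0 mxE ?sRe0 ?sIm0.
Qed.

Lemma smooth_section_mult_ext s t : section_mult_ext s t -> smooth_section t ->
  smooth_section s.
Proof.
move=> st ts c i a; have [h1 h2] := section_mult_ext_parts i a st.
have [t1 t2] := ts c i a.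
by split; [apply: smooth_mult_ext h1 _|apply: smooth_mult_ext h2 _].
Qed.

(** This is the source of all continuity statements about extension by zero. The
    bound [r] is the sum of the seminorms of [t] over [L `&` K] for the
    derivatives occurring in the Leibniz rule; the factor 2 stems from
    estimating the real and the imaginary part separately. *)
Lemma section_mult_ext_dominate (p : Gamma F -> R) : lcs_gen p ->
  exists2 r : Gamma G -> R, csn r & forall (s : Gamma F) (t : Gamma G),
    section_mult_ext (section_fun s) (section_fun t) -> p s <= r t.
Proof.
move=> [c [i [L [l [a [cL LO ->]]]]]].
have [B [ls [B0 H]]] := mult_ext_bound l (oF i) cL LO.
pose LK : set (open_submanifold U) := [set x | (L `&` K) (val x)].
have cLK : compact LK.
  by apply: compact_preim_val => [|x [_ /KU]//]; apply: compact_closedI.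
have LKO : LK `<=` @cdom _ _ (open_submanifold U) c `&` @tdom _ _ _ _ G i.
  by move=> x [/LO].
have LKge := section_seminorm_ge hU over_sub_open _ _ _ cLK LKO.
exists (fun t => \sum_(l' <- ls) (B * 2) * @section_seminorm R k n _ G c i LK l' a t).
  apply: csn_sum => l'; apply: csnZ; first by rewrite mulr_ge0.
  by apply: csn_section_seminorm => //; exact: over_sub_open.
move=> s t st; have [h1 h2] := section_mult_ext_parts i a st.
have [t1 t2] := section_smooth t c i a.
have B2 : 0 <= B * 2 by rewrite mulr_ge0.
apply: section_seminorm_le => [|x Lx].
  by apply: sumr_ge0 => l' _; rewrite mulr_ge0 // section_seminorm_ge0.
have [H1 H1'] := H _ _ h1 t1 _ Lx; have [H2 H2'] := H _ _ h2 t2 _ Lx.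
apply: le_trans (hypot_le _ _) _; rewrite /coord_partial.
have [Kx|nKx] := pselect (K x); last first.
  rewrite H1 // H2 // normr0 addr0.
  by apply: sumr_ge0 => l' _; rewrite mulr_ge0 // section_seminorm_ge0.
apply: le_trans (lerD (H1' Kx) (H2' Kx)) _.
rewrite -mulrDr -big_split -mulr_sumr -mulrA ler_wpM2l // mulr_sumr.
apply: ler_sum => l' _ /=.
have := LKge l' a t (pt_of (KU Kx)) (conj Lx Kx).
set u := section_seminorm _ _ _ _ _ _ => hu.
have := le_trans (le_hypotl _ _) hu; have := le_trans (le_hypotr _ _) hu.
rewrite /coord_partial /= => a1 a2; have := lerD a2 a1.
by rewrite mulrDl mul1r.
Qed.

End Transfer.

(** * Multiplication by a bump function and extension of densities *)

Section Restrict.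
Variables (R : realType) (k : scalar_kind) (n : nat) (M : premanifold R n).
Variables (hM : is_manifold M) (U : set M) (oU : open U).
Variables (E : prebundle k M) (hE : is_vbundle E).
Let chM := manifold_charted hM.
Let hausM := manifold_hausdorff hM.
Local Notation EU := (bundle_restr U E).

Lemma open_tdom_dual (i : triv (dual_vol E)) : open (tdom i).
Proof. by apply: openI; [exact: cdom_open|exact: tdom_open]. Qed.

Lemma of_real1 : of_real k 1 = 1 :> scalars R k. Proof. by case: k. Qed.
Lemma of_real0 : of_real k 0 = 0 :> scalars R k. Proof. by case: k. Qed.

Section Mult.
Variables (chi : M -> R) (chis : forall c, smooth_in_chart c setT chi).
Variables (K : set M) (cK : compact K) (KU : K `<=` U).
Variable (chi0 : forall x, ~ K x -> chi x = 0).

Definition mult_raw (t : raw_section EU) : raw_section E := fun x =>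
  match pselect (U x) with
  | left h => of_real k (chi x) *: (t (pt_of h) : fibre E x)
  | right _ => 0
  end.

Lemma mult_raw_val t (x : open_submanifold U) :
  mult_raw t (val x) = of_real k (chi (val x)) *: (t x : fibre E (val x)).
Proof.
case: x => x p /=; rewrite /mult_raw; case: pselect => [h|[]]; last exact: set_mem.
by rewrite (bool_irrelevance p (mem_set h)).
Qed.

Lemma mult_raw_ext t : section_mult_ext chi K (F := E) (tm := @tmap _ _ _ _ EU)
  (mult_raw t) t.
Proof.
split=> [i a x|x nKx]; first by rewrite /Defs.coord mult_raw_val linearZ mxE.
rewrite /mult_raw; case: pselect => // h; by rewrite chi0 // of_real0 scale0r.
Qed.

Lemma mult_raw_smooth (t : Gamma EU) :
  mult_raw (section_fun t) \in @smooth_section_pred R k n M E.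
Proof.
apply/asboolP; apply: (smooth_section_mult_ext chM hausM oU chis cK KU _ (mult_raw_ext _)).
  by move=> i; exact: tdom_open.
exact: section_smooth.
Qed.

Definition mult_section (t : Gamma EU) : Gamma E := Section (mult_raw_smooth t).

Lemma eq_section (s t : Gamma E) :
  (forall x, section_fun s x = section_fun t x) -> s = t.
Proof. by move=> st; apply: val_inj; exact: functional_extensionality_dep. Qed.

(** The pair (mult_section t, t) satisfies [section_mult_ext] with the bump
    function and its support. *)
Lemma mult_section_cont : cont_linear mult_section.
Proof.
apply: cont_linear_dominated.
- move=> a s t; apply: eq_section => x /=; rewrite /mult_raw.
  rewrite -[RHS]/(a *: mult_raw (section_fun s) x + mult_raw (section_fun t) x).
  rewrite /mult_raw; case: pselect => h; last by rewrite scaler0 addr0.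
  rewrite -[X in of_real k _ *: X]/(a *: (section_fun s (pt_of h) : fibre E x)
    + section_fun t (pt_of h)).
  by rewrite scalerDr !scalerA [_ * a]mulrC.
- by move=> _ [c [i [L [l [a [_ _ ->]]]]]] x; exact: section_seminorm_ge0.
move=> p pg; have [i|r rc H] := section_mult_ext_dominate chM hausM oU chis cK KU _
  (@tmap _ _ _ _ EU) pg.
  exact: tdom_open.
by exists r => // t; apply: H; exact: mult_raw_ext.
Qed.

End Mult.

Section Ext0.
Implicit Types w : Gammac (dual_vol EU).

Lemma dual_density_sub (x : open_submanifold U) (w : dual_density EU x) :
  (dd_fun w : chart M -> fibre E (val x) -> (scalars R k)^o) \in
    @dual_density_pred R k n M E (val x).
Proof.
have /asboolP[w1 w2 w3] := dd_funP w; apply/asboolP; split=> //.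
move=> c c' cx c'x e; have := w3 c c' cx c'x e.
by rewrite (jacobian_sub chM oU).
Qed.

(** The extension by zero, with the proof that the value at each point of [U] is
    a density on [M] built in; [ext0] agrees with it ([ext0E]). *)
Definition ext0_raw w : raw_section (dual_vol E) := fun x =>
  match pselect (U x) with
  | left h => DualDensity (dual_density_sub (csection_fun w (pt_of h)))
  | right _ => 0
  end.

Lemma ext0_raw_val w (x : open_submanifold U) :
  ext0_raw w (val x) = DualDensity (dual_density_sub (csection_fun w x)).
Proof.
case: x => x p /=; rewrite /ext0_raw; case: pselect => [h|[]]; last exact: set_mem.
by rewrite (bool_irrelevance p (mem_set h)).
Qed.

Lemma ext0_raw_ext w (L : set (open_submanifold U)) :
  supp (csection_fun w) `<=` L ->
  section_mult_ext (cst 1) (val @` L) (F := dual_vol E) (tm := @tmap _ _ _ _ (dual_vol EU))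
    (ext0_raw w) (csection_fun w).
Proof.
move=> wL; split=> [i a x|x nLx].
  by rewrite /Defs.coord ext0_raw_val of_real1 mul1r !mxE.
rewrite /ext0_raw; case: pselect => // h.
have w0 : csection_fun w (pt_of h) = 0.
  apply: contrapT => wx; apply: nLx; exists (pt_of h) => //.
  by apply: wL; exact: subset_closure.
by apply: val_inj => /=; rewrite w0.
Qed.

Lemma val_image_sub (L : set (open_submanifold U)) : val @` L `<=` U.
Proof. by move=> _ [x _ <-]; exact: val_in_sub. Qed.

Lemma csection_smooth_compact (N : premanifold R n) (F : prebundle k N) (w : Gammac F) :
  smooth_section (csection_fun w) /\ compact (supp (csection_fun w)).
Proof. by have /asboolP := csection_funP w. Qed.

Lemma supp_ext0_raw w : supp (ext0_raw w) `<=` val @` supp (csection_fun w).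
Proof.
have [_ wc] := csection_smooth_compact w.
have wx := ext0_raw_ext (@subset_refl _ (supp (csection_fun w))).
have clK := compact_closed hausM (compact_image_val wc).
rewrite [X in _ `<=` X](iffLR (closure_id _) clK).
by apply: closure_subset => x nx; apply: contrapT => nKx; exact: nx (wx.2 x nKx).
Qed.

Lemma ext0_raw_csection w : ext0_raw w \in @csection_pred R k n M (dual_vol E).
Proof.
have [ws wc] := csection_smooth_compact w.
have wx := ext0_raw_ext (@subset_refl _ (supp (csection_fun w))).
have cK := compact_image_val wc.
apply/asboolP; split.
  apply: (smooth_section_mult_ext chM hausM oU _ cK (@val_image_sub _) _ wx) => //.
    by move=> c; apply: (smooth_in_chart_cst chM); exact: openT.
  exact: open_tdom_dual.
apply: (subclosed_compact _ cK); first exact: closed_closure.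
exact: supp_ext0_raw.
Qed.

Lemma ext0E w : csection_fun (ext0 w) = ext0_raw w.
Proof.
rewrite /ext0 -[LHS]/(val _).
set r := (X in insubd _ X); have -> : r = ext0_raw w.
  apply: functional_extensionality_dep => x; rewrite /r /ext0_raw.
  case: pselect => // h; apply: val_inj => /=.
  by rewrite insubdK //; exact: (dual_density_sub (csection_fun w (pt_of h))).
by rewrite insubdK //; exact: ext0_raw_csection.
Qed.

Lemma eq_csection (N : premanifold R n) (F : prebundle k N) (s t : Gammac F) :
  (forall x, csection_fun s x = csection_fun t x) -> s = t.
Proof. by move=> st; apply: val_inj; exact: functional_extensionality_dep. Qed.

Lemma ext0_linear (a : scalars R k) w w' : ext0 (a *: w + w') = a *: ext0 w + ext0 w'.
Proof.
apply: eq_csection => x.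
rewrite -[RHS]/(a *: csection_fun (ext0 w) x + csection_fun (ext0 w') x) !ext0E.
rewrite /ext0_raw; case: pselect => h; last by rewrite scaler0 addr0.
exact: val_inj.
Qed.

(** For the (LF) topology a seminorm is continuous as soon as it is dominated on
    the sections supported in each compact set [L]. On these, [ext0 w] and [w]
    form a pair as in [section_mult_ext], with chi = 1 and the compact set
    [val @` L]. *)
Lemma ext0_cont : cont_linear (@ext0 R k n M U E).
Proof.
apply: cont_linear_dominated; first exact: ext0_linear.
  by move=> p [ps _] x; exact: seminorm_ge0.
move=> p [ps pg]; exists (p \o @ext0 R k n M U E) => //.
have sp : is_seminorm (p \o @ext0 R k n M U E).
  exact: (@comp_seminorm _ _ (Gammac (dual_vol EU)) (Gammac (dual_vol E)) _ _ ext0_linear ps).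
apply: csn_gen => //; split=> // L cL.
have cK := compact_image_val cL.
have [q qc pq] := pg _ cK.
pose T := {w : Gammac (dual_vol EU) | supp (csection_fun w) `<=` L}.
have [||r rc qr] := @csn_dominate _ _ (Gamma (dual_vol EU)) (Gamma (dual_vol E)) T
  (fun v => csection_section (ext0 (sval v))) (fun v => csection_section (sval v)) _ _ q qc.
- by move=> _ [c [i [L' [l [a [_ _ ->]]]]]] x; exact: section_seminorm_ge0.
- move=> p' p'g; have [c||r rc H] := section_mult_ext_dominate (chi := cst 1) (F := dual_vol E)
    chM hausM oU _ cK (@val_image_sub _) _ (@tmap _ _ _ _ (dual_vol EU)) p'g.
  + by apply: (smooth_in_chart_cst chM); exact: openT.
  + exact: open_tdom_dual.
  exists r => // -[w wL]; apply: H => /=; rewrite ext0E; exact: ext0_raw_ext.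
exists r => // w wL; apply: le_trans (qr (exist _ w wL)); apply: pq.
rewrite ext0E; apply: subset_trans (@supp_ext0_raw w) _; exact: image_subset.
Qed.

End Ext0.
End Restrict.

(** * Restriction of embedded distributions *)

Section Eval.
Variables (R : realType) (k : scalar_kind).
Implicit Types A B : lcs R k.

Lemma eq_clin A B (f g : clin A B) : (forall x, clin_fun f x = clin_fun g x) -> f = g.
Proof. by move=> fg; apply: val_inj; apply/funext. Qed.

Lemma clin_gen_seminorm A B (q : B -> R) (D : set A) : csn q -> bounded_in D ->
  is_seminorm (fun f : clin A B => sup [set q (clin_fun f x) | x in D]).
Proof.
move=> qc bD; apply: (@sup_seminorm _ _ _ _ D (fun x (f : clin A B) => q (clin_fun f x))).
  by move=> x _; have [[qD qZ] _] := qc; split=> [f g|a f]; [exact: qD|exact: qZ].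
move=> f; have [C HC] := bD _ ((clinP f).2 _ qc).
by exists C => _ [x Dx <-]; exact: HC.
Qed.

Lemma csn_eval A B (x : A) (q : B -> R) : csn q -> csn (fun f : clin A B => q (clin_fun f x)).
Proof.
move=> qc; have [[qD qZ] _] := qc; apply: csn_gen; first by split=> [f g|a f]; [exact: qD|exact: qZ].
exists q, [set x]; split=> //; first by move=> p _; exists (p x) => _ ->.
by apply/funext => f; rewrite image_set1 sup1.
Qed.

Lemma eval_cont A B (x : A) : cont_linear (fun f : clin A B => clin_fun f x).
Proof. by split=> // q; exact: csn_eval. Qed.

(** The derivatives of [f \o c] are the images under [f] of those of [c]. *)
Lemma cont_linear_smooth A B (f : A -> B) : cont_linear f -> conv_smooth f.
Proof.
move=> [fl fc] c [d [<- dP]]; exists (fun i => f \o d i); split=> // i t p pc.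
have f0 := linear_map0 fl.
have fZ a x : f (a *: x) = a *: f x by have := fl a x 0; rewrite !addr0 f0 addr0.
have fB x y : f (x - y) = f x - f y.
  by rewrite -[x]scale1r addrC -scaleN1r fl scaleN1r scale1r addrC.
apply: cvg_trans (dP i t _ (fc _ pc)); apply: near_eq_cvg; apply: nearW => h.
by rewrite /= fB fZ fB.
Qed.

End Eval.

Section Main.
Variables (R : realType) (k : scalar_kind) (n : nat) (M : premanifold R n).
Variables (hM : is_manifold M) (U : set M) (oU : open U).
Variables (E : prebundle k M) (hE : is_vbundle E).
Local Notation EU := (bundle_restr U E).

Lemma distr_restrE (v : Distr E) w :
  clin_fun (distr_restr U v) w = clin_fun v (ext0 w).
Proof.
rewrite /distr_restr.
by rewrite (to_clinE (cont_linear_comp (ext0_cont hM oU hE) (clinP v))).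
Qed.

(** The transpose of a continuous linear map: the seminorm given by a bounded set
    [D] pulls back to the one given by its image under [ext0], which is bounded
    again. *)
Lemma distr_restr_cont : cont_linear (@distr_restr R k n M U E).
Proof.
have ec := ext0_cont hM oU hE.
apply: cont_linear_dominated.
- move=> a v v'; apply: eq_clin => w.
  rewrite -[RHS]/(a *: clin_fun (distr_restr U v) w + clin_fun (distr_restr U v') w).
  by rewrite !distr_restrE.
- move=> _ [q [D [qc _ ->]]] v.
  set S := [set _ | _ in _].
  have [hS|/sup_out->//] := pselect (has_sup S).
  have [[r Sr] _] := hS; apply: le_trans (sup_upper_bound hS Sr).
  by case: Sr => w _ <-; exact: csn_ge0 qc.
move=> _ [q [D [qc bD ->]]].
pose r (v : Distr E) := sup [set q (clin_fun v w) | w in (@ext0 R k n M U E) @` D].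
have bD' : bounded_in ((@ext0 R k n M U E) @` D).
  move=> p pc; have [C HC] := bD _ (ec.2 _ pc); exists C => _ [w Dw <-]; exact: HC.
exists r; last first.
  move=> v; rewrite /r image_comp.
  suff -> : [set q (clin_fun (distr_restr U v) x) | x in D] =
      [set (fun w => q (clin_fun v w)) (ext0 x) | x in D] by [].
  by congr image; apply/funext => w; rewrite distr_restrE.
apply: csn_gen; last by exists q, (@ext0 R k n M U E @` D).
by apply: clin_gen_seminorm.
Qed.

Lemma iota_local (N : premanifold R n) (F : prebundle k N) (v : Distr F) : local (iota_emb v).
Proof.
split; last by move=> Phi Phi' O oO H x Ox; exact: H.
exact: (cont_linear_smooth (@eval_cont _ _ (Distr F) (Gamma F) v)).
Qed.

Lemma iota_is_restriction (u : Distr E) :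
  is_restriction (iota_emb u) (iota_emb (distr_restr U u)).
Proof.
split; first exact: iota_local.
by move=> W Phi Phi' oW WU H x Wx; exact: H.
Qed.

(** [Phi'] is v |-> chi . Phi(v|_U), with chi = 1 on [W]. *)
Lemma vso_extension (Phi : VSO EU) (x0 : open_submanifold U) :
  exists (Phi' : VSO E) (W : set M), [/\ open W, W `<=` U, W (val x0) &
    forall (v : Distr E) (x : open_submanifold U), W (val x) ->
       section_fun (clin_fun Phi (distr_restr U v)) x
         = section_fun (clin_fun Phi' v) (val x) :> fibre E (val x)].
Proof.
have [chi [K [W [[cK KU chi0] [[oW Wx WU W1] chis]]]]] := bump hM oU (val_in_sub x0).
pose f (v : Distr E) := mult_section hM oU hE chis cK KU chi0 (clin_fun Phi (distr_restr U v)).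
have fc : cont_linear f.
  apply: (cont_linear_comp (cont_linear_comp distr_restr_cont (clinP Phi))).
  exact: mult_section_cont.
exists (to_clin f), W; split=> // v x Wvx.
by rewrite to_clinE //= mult_raw_val W1 // of_real1 scale1r.
Qed.

Lemma restriction_iota (u : Distr E) :
  restriction U (iota_emb u) = iota_emb (distr_restr U u).
Proof.
apply: xget_unique; first exact: iota_is_restriction.
move=> Q [_ HQ]; apply/funext => Phi; apply: val_inj.
apply: functional_extensionality_dep => x.
have [Phi' [W [oW WU Wx H]]] := vso_extension Phi x.
transitivity (section_fun (iota_emb u Phi') (val x)); first exact: HQ Wx.
by rewrite [RHS]H.
Qed.

End Main.

Theorem theorem8p11 (R : realType) (k : scalar_kind) (n : nat)
    (M : premanifold R n) (hM : is_manifold M)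
    (E : prebundle k M) (hE : is_vbundle E) (hnat : natural_bundle E)
    (M' : set M) (hM' : open M') (u : Distr E) :
  gclass (restriction M' (iota_emb u)) = gclass (iota_emb (distr_restr M' u)).
Proof. by rewrite restriction_iota. Qed.
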